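(* Let $M$ be an $m$-dimensional complex manifold carrying a Hermitian metric whose holomorphic sectional curvature is bounded from above by a negative number $-K$. Let $\Omega\subset\mathbb{C}^m$ be a bounded domain whose Bergman metric is complete and has Ricci curvature bounded from below by a negative number $-k$. Assume that $M$ is a monotone union of $\Omega$ via biholomorphisms $f_j$, and that there exists a point $q\in M$ such that $f_j(q)\to p$ as $j\to\infty$, where $p\in\partial\Omega$ is a strongly pseudoconvex boundary point. Then there exists $\eta>0$ such that $$\frac{|\det Jf_j(q)|}{\delta(f_j(q))^{\frac{m+1}{2}}}\ge\eta$$ for all sufficiently large $j$.
   Context: For a domain $\Omega\subset\mathbb{C}^m$ and an $m$-dimensional complex manifold $M$, one says that $M$ is a monotone union of $\Omega$ via $f_j$ if there is a sequence of open subsets $M_j\subset M$ ($j=1,2,\dots$) such that $M_j\Subset M_{j+1}$ (relatively compact) for every $j$, $M=\bigcup_j M_j$, and for each $j$ the map $f_j:M_j\to\Omega$ is a biholomorphism of $M_j$ onto $\Omega$. The value $f_j(q)$ is defined for all $j$ large enough that $q\in M_j$. $Jf_j(q)$ is the complex Jacobian matrix of $f_j$ at $q$, computed with respect to a fixed holomorphic coordinate system of $M$ around $q$ (independent of $j$) and the standard coordinates of $\mathbb{C}^m$. $\delta(x)$ denotes the distance from $x\in\Omega$ to $\partial\Omega$. *)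

(* Defs.v *)
From HB Require Import structures.
From mathcomp Require Import all_boot all_order all_algebra.
From mathcomp Require Import all_classical all_reals all_analysis.
From mathcomp Require Import complex.

Set Implicit Arguments.
Unset Strict Implicit.
Unset Printing Implicit Defensive.

Import Order.TTheory GRing.Theory Num.Theory.
Import numFieldNormedType.Exports.

Local Open Scope classical_set_scope.
Local Open Scope ring_scope.
Local Open Scope complex_scope.
Local Open Scope sesquilinear_scope.

(* [R[i]] seen as a numClosedFieldType: this is what lets the normed topology
   of MathComp-Analysis be inferred on complex numbers and on ['rV[Cx R]_m].
   Over [Cx R], [differentiable] is complex differentiability and ['J f z] is
   the complex Jacobian matrix (acting on row vectors, so transposed with
   respect to the usual column convention). *)
Definition Cx (R : realType) : numClosedFieldType := R[i].

Definition cabs (R : realType) (z : Cx R) : R := complex.Re `|z|.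

Definition eucl_norm (R : realType) (m : nat) (v : 'rV[Cx R]_m) : R :=
  Num.sqrt (\sum_(k < m) cabs (v 0 k) ^+ 2).

(* Derivatives with respect to a real parameter. *)

Definition rderivable (R : realType) (u : R -> Cx R) (t : R) : Prop :=
  derivable (fun s => complex.Re (u s)) t 1 /\
  derivable (fun s => complex.Im (u s)) t 1.

Definition rderive (R : realType) (u : R -> Cx R) (t : R) : Cx R :=
  derive1 (fun s => complex.Re (u s)) t +i* derive1 (fun s => complex.Im (u s)) t.

Section RealCalculus.
Context (R : realType) (m : nat).
Implicit Types (F : 'rV[Cx R]_m -> Cx R) (z v : 'rV[Cx R]_m).

Definition line F z v (t : R) : Cx R := F (z + (t%:C : Cx R) *: v).

Definition rdir v F z : Cx R := rderive (line F z v) 0.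

(* [F] is of class C^n, in the real sense, on the open set [U]. *)
Fixpoint classC (n : nat) (U : set 'rV[Cx R]_m) F : Prop :=
  (forall z, U z -> {for z, continuous F}) /\
  match n with
  | 0 => True
  | n'.+1 => forall v, (forall z, U z -> rderivable (line F z v) 0) /\
                       classC n' U (rdir v F)
  end.

Definition smooth (U : set 'rV[Cx R]_m) F : Prop := forall n, classC n U F.

Definition evec (k : 'I_m) : 'rV[Cx R]_m := delta_mx 0 k.

(* Wirtinger operators d/dz_k = (d/dx_k - i d/dy_k) / 2 and
   d/dzbar_k = (d/dx_k + i d/dy_k) / 2. *)
Definition dz (k : 'I_m) F z : Cx R :=
  (rdir (evec k) F z - 'i * rdir ('i *: evec k) F z) / 2.

Definition dzbar (k : 'I_m) F z : Cx R :=
  (rdir (evec k) F z + 'i * rdir ('i *: evec k) F z) / 2.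

End RealCalculus.

(* Hermitian tensors on open subsets of C^m: a matrix [A] encodes the form
   (v, w) |-> \sum_(i, j) A_ij v_i conj(w_j). *)

Definition sesq (R : realType) (m : nat) (A : 'M[Cx R]_m) (v w : 'rV[Cx R]_m)
  : Cx R := (v *m A *m w ^t*) 0 0.

Section Curvature.
Context (R : realType) (m : nat).
Implicit Types (G : 'rV[Cx R]_m -> 'M[Cx R]_m) (z v : 'rV[Cx R]_m).

Definition dzmx (k : 'I_m) G z : 'M[Cx R]_m :=
  \matrix_(i, j) dz k (fun w => G w i j) z.

Definition dzbarmx (k : 'I_m) G z : 'M[Cx R]_m :=
  \matrix_(i, j) dzbar k (fun w => G w i j) z.

(* Curvature of the Chern connection of the metric g_{i jbar} = G_ij: the
   (i, j) entry of [chern_curv G k l] is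
     R_{i jbar k lbar} = - d_k d_lbar g_{i jbar}
       + \sum_(p, q) g^{qbar p} (d_k g_{i qbar}) (d_lbar g_{p jbar}). *)
Definition chern_curv G (k l : 'I_m) z : 'M[Cx R]_m :=
  - dzmx k (dzbarmx l G) z + dzmx k G z *m invmx (G z) *m dzbarmx l G z.

(* R(v, vbar, v, vbar) / |v|^4 *)
Definition hol_sect_curv G z v : R :=
  complex.Re (\sum_(k < m) \sum_(l < m)
    v 0 k * (v 0 l)^* * sesq (chern_curv G k l z) v v)
  / complex.Re (sesq (G z) v v) ^+ 2.

(* Ric_{k lbar} = \sum_(i, j) g^{jbar i} R_{i jbar k lbar} *)
Definition ricci G z : 'M[Cx R]_m :=
  \matrix_(k, l) \tr (chern_curv G k l z *m invmx (G z)).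

End Curvature.

(* Riemannian distance of a Hermitian tensor [G] on an open set of C^m. *)

Section MetricDistance.
Context (R : realType) (m : nat).
Context (D : set 'rV[Cx R]_m) (G : 'rV[Cx R]_m -> 'M[Cx R]_m).

(* A C^1 curve on [0, 1] always extends to a C^1 curve on the real line. *)
Definition C1_curve (g : R -> 'rV[Cx R]_m) : Prop :=
  forall k : 'I_m,
    (forall t, rderivable (fun s => g s 0 k) t) /\
    continuous (rderive (fun s => g s 0 k) : R -> Cx R).

Definition velocity (g : R -> 'rV[Cx R]_m) (t : R) : 'rV[Cx R]_m :=
  \row_k rderive (fun s => g s 0 k) t.

Definition arc_length (g : R -> 'rV[Cx R]_m) : R :=
  Rintegral lebesgue_measure `[0%R, 1%R]
    (fun t => Num.sqrt (complex.Re (sesq (G (g t)) (velocity g t) (velocity g t)))).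

(* [pw_path x y L]: some piecewise C^1 curve in [D] from [x] to [y] has
   length [L]. *)
Inductive pw_path : 'rV[Cx R]_m -> 'rV[Cx R]_m -> R -> Prop :=
| pw_arc (g : R -> 'rV[Cx R]_m) of C1_curve g
    & (forall t, 0 <= t <= 1 -> D (g t)) : pw_path (g 0) (g 1) (arc_length g)
| pw_cat x y w L1 L2 of pw_path x y L1 & pw_path y w L2 :
    pw_path x w (L1 + L2).

Definition metric_dist (x y : 'rV[Cx R]_m) : R :=
  inf [set L | pw_path x y L].

Definition complete_metric : Prop :=
  forall u : nat -> 'rV[Cx R]_m,
    (forall n, D (u n)) ->
    (forall e : R, 0 < e -> exists N : nat, forall a b : nat,
       (N <= a)%N -> (N <= b)%N -> metric_dist (u a) (u b) < e) ->
    exists2 x, D x &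
      forall e : R, 0 < e -> \forall n \near \oo, metric_dist (u n) x < e.

End MetricDistance.

(* Lebesgue measure on C^n, built as a product of 2n copies of the Lebesgue
   measure of the real line: [leb n] is a space with its measure, and [leb_pt]
   identifies the points of that space with C^n.  The order of the factors is
   irrelevant; this one only needs the right-hand factor of each product to be
   sigma-finite, which is the instance available for [_ \x _]. *)

Record msr_space (R : realType) := MsrSpace {
  msr_disp : measure_display ;
  msr_type : measurableType msr_disp ;
  msr_mu : {measure set msr_type -> \bar R} }.

Definition msr_times_line (R : realType) (A : msr_space R) : msr_space R :=
  MsrSpace (product_measure1 (msr_mu A) (@lebesgue_measure R)
    : {measure set (msr_type A * measurableTypeR R)%type -> \bar R}).

Fixpoint leb (R : realType) (n : nat) : msr_space R :=
  match n with
  | 0 => MsrSpace (dirac tt : {measure set unit -> \bar R})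
  | n'.+1 => msr_times_line (msr_times_line (leb R n'))
  end.

Fixpoint leb_pt (R : realType) (n : nat) : msr_type (leb R n) -> 'rV[Cx R]_n :=
  match n return msr_type (leb R n) -> 'rV[Cx R]_n with
  | 0 => fun _ => 0
  | n'.+1 => fun t : msr_type (leb R n') * R * R =>
      row_mx (const_mx (t.1.2 +i* t.2) : 'rV[Cx R]_1) (leb_pt t.1.1)
  end.

Section Bergman.
Context (R : realType) (m : nat).
Context (D : set 'rV[Cx R]_m).
Implicit Types (f : 'rV[Cx R]_m -> Cx R) (K : 'rV[Cx R]_m -> 'rV[Cx R]_m -> Cx R).

Definition cintegral f : Cx R :=
  Rintegral (msr_mu (leb R m)) (@leb_pt R m @^-1` D)
    (fun t => complex.Re (f (leb_pt t)))
  +i*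
  Rintegral (msr_mu (leb R m)) (@leb_pt R m @^-1` D)
    (fun t => complex.Im (f (leb_pt t))).

(* The Bergman space of square-integrable holomorphic functions. *)
Definition bergman_space f : Prop :=
  (forall z, D z -> differentiable f z) /\
  (\int[msr_mu (leb R m)]_(t in @leb_pt R m @^-1` D)
     (cabs (f (leb_pt t)) ^+ 2)%:E < +oo)%E.

Definition reproducing K : Prop :=
  forall w, D w ->
    bergman_space (fun z => K z w) /\
    forall f, bergman_space f -> f w = cintegral (fun z => f z * (K z w)^*).

(* On [D] x [D] the reproducing kernel exists and is unique. *)
Definition bergman_kernel : 'rV[Cx R]_m -> 'rV[Cx R]_m -> Cx R :=
  xget (fun _ _ => 0) reproducing.

Definition bergman_metric (z : 'rV[Cx R]_m) : 'M[Cx R]_m :=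
  \matrix_(i, j)
    dz i (dzbar j (fun w => (ln (complex.Re (bergman_kernel w w)))%:C)) z.

End Bergman.

Section Domains.
Context (R : realType) (m : nat).
Implicit Types (D : set 'rV[Cx R]_m) (p : 'rV[Cx R]_m).

Definition bounded_domain D : Prop :=
  [/\ D !=set0, open D, connected D & bounded_set D].

Definition bdry D : set 'rV[Cx R]_m := closure D `\` interior D.

Definition dist_bdry D (x : 'rV[Cx R]_m) : R :=
  inf [set eucl_norm (x - y) | y in bdry D].

Definition strongly_psc_point D p : Prop :=
  bdry D p /\
  exists (U : set 'rV[Cx R]_m) (r : 'rV[Cx R]_m -> R),
    let rc : 'rV[Cx R]_m -> Cx R := fun z => (r z)%:C in
    [/\ open U /\ U p,
        classC 2 U rc,
        (forall z, U z -> (D z <-> r z < 0)),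
        (exists v, rdir v rc p != 0) &
        forall v : 'rV[Cx R]_m, v != 0 ->
          \sum_(i < m) dz i rc p * v 0 i = 0 ->
          0 < complex.Re
                (sesq (\matrix_(i, j) dz i (dzbar j rc) p) v v)].

End Domains.

(* Complex manifolds.  Only the values of [chart_map] on [chart_dom] and of
   [chart_inv] on the image of the chart are meaningful. *)

Record chart (R : realType) (m : nat) (M : topologicalType) := Chart {
  chart_dom : set M ;
  chart_map : M -> 'rV[Cx R]_m ;
  chart_inv : 'rV[Cx R]_m -> M }.

Definition chart_img (R : realType) (m : nat) (M : topologicalType)
  (c : chart R m M) : set 'rV[Cx R]_m := chart_map c @` chart_dom c.

Definition is_chart (R : realType) (m : nat) (M : topologicalType)
    (c : chart R m M) : Prop :=
  [/\ open (chart_dom c), open (chart_img c),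
      (forall x, chart_dom c x -> chart_inv c (chart_map c x) = x),
      (forall x, chart_dom c x -> {for x, continuous (chart_map c)}) &
      (forall z, chart_img c z -> {for z, continuous (chart_inv c)})].

Definition transition (R : realType) (m : nat) (M : topologicalType)
  (c c' : chart R m M) : 'rV[Cx R]_m -> 'rV[Cx R]_m :=
  chart_map c' \o chart_inv c.

Definition holo_transition (R : realType) (m : nat) (M : topologicalType)
    (c c' : chart R m M) : Prop :=
  forall x, chart_dom c x -> chart_dom c' x ->
    differentiable (transition c c') (chart_map c x).

Record complex_manifold (R : realType) (m : nat) := ComplexManifold {
  cm_space :> topologicalType ;
  cm_atlas : set (chart R m cm_space) ;
  cm_hausdorff : hausdorff_space cm_space ;
  cm_countable : @second_countable cm_space ;
  cm_charts : forall c, cm_atlas c -> is_chart c ;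
  cm_cover : forall x, exists2 c, cm_atlas c & chart_dom c x ;
  cm_compat : forall c c', cm_atlas c -> cm_atlas c' -> holo_transition c c' ;
  cm_maximal : forall c, is_chart c ->
    (forall c', cm_atlas c' -> holo_transition c c' /\ holo_transition c' c) ->
    cm_atlas c }.

Section Manifolds.
Context (R : realType) (m : nat) (M : complex_manifold R m).

(* Here [differentiable] reads [f], resp. [g], in the coordinates of [c]. *)
Definition holo_from (U : set M) (f : M -> 'rV[Cx R]_m) : Prop :=
  forall (c : chart R m M) (x : M), cm_atlas c -> chart_dom c x -> U x ->
    differentiable (f \o chart_inv c) (chart_map c x).

Definition holo_to (D : set 'rV[Cx R]_m) (g : 'rV[Cx R]_m -> M) : Prop :=
  forall z, D z -> {for z, continuous g} /\
    forall c : chart R m M, cm_atlas c -> chart_dom c (g z) ->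
      differentiable (chart_map c \o g) z.

Definition biholomorphism (U : set M) (D : set 'rV[Cx R]_m)
    (f : M -> 'rV[Cx R]_m) : Prop :=
  [/\ set_bij U D f, holo_from U f &
      exists g : 'rV[Cx R]_m -> M,
        holo_to D g /\ forall x, U x -> g (f x) = x].

(* [f j] is only meaningful on [N j]. *)
Definition monotone_union (D : set 'rV[Cx R]_m) (N : nat -> set M)
    (f : nat -> M -> 'rV[Cx R]_m) : Prop :=
  [/\ (forall j, open (N j)),
      (forall j, compact (closure (N j)) /\ closure (N j) `<=` N j.+1),
      \bigcup_j N j = setT &
      forall j, biholomorphism (N j) D (f j)].

(* A Hermitian metric, given by its matrix in every holomorphic chart. *)
Definition hermitian_metric (h : chart R m M -> 'rV[Cx R]_m -> 'M[Cx R]_m)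
    : Prop :=
  [/\ (forall c, cm_atlas c -> forall i j,
         smooth (chart_img c) (fun z => h c z i j)),
      (forall c z, cm_atlas c -> chart_img c z ->
         (h c z) ^t* = h c z /\
         forall v, v != 0 -> 0 < complex.Re (sesq (h c z) v v)) &
      (forall c c' (x : M), cm_atlas c -> cm_atlas c' ->
         chart_dom c x -> chart_dom c' x ->
         let J := 'J (transition c c') (chart_map c x) in
         h c (chart_map c x) = J *m h c' (chart_map c' x) *m J ^t*)].

Definition hol_sect_curv_le (h : chart R m M -> 'rV[Cx R]_m -> 'M[Cx R]_m)
    (a : R) : Prop :=
  forall c z v, cm_atlas c -> chart_img c z -> v != 0 ->
    hol_sect_curv (h c) z v <= a.

End Manifolds.

Definition ricci_ge (R : realType) (m : nat) (D : set 'rV[Cx R]_m)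
    (G : 'rV[Cx R]_m -> 'M[Cx R]_m) (a : R) : Prop :=
  forall z v, D z ->
    a * complex.Re (sesq (G z) v v) <= complex.Re (sesq (ricci G z) v v).

(* Main.v *)
Require Import Defs.
From HB Require Import structures.
From mathcomp Require Import all_boot all_order all_algebra.
From mathcomp Require Import all_classical all_reals all_analysis.
From mathcomp Require Import perm complex ring lra.

Set Implicit Arguments.
Unset Strict Implicit.
Unset Printing Implicit Defensive.

Import Order.TTheory GRing.Theory Num.Theory.
Import numFieldNormedType.Exports.

Local Open Scope classical_set_scope.
Local Open Scope ring_scope.

(** Each f_j maps M_j biholomorphically onto Omega, so it is itself a chart of M
([biholomorphism_chart]). Read in this chart, the Hermitian metric of M is a metric g_j on
Omega, whose holomorphic sectional curvature is at most -K, and the transformation rule at q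
says that

  det h(q) = |det J f_j(q)|^2 det g_j(f_j(q)).

The left-hand side does not depend on j, hence the theorem amounts to an upper bound
det g_j(x) <= C delta(x)^-(m+1) at the points x = f_j(q), uniformly in j.

Such a bound follows from the presence of large discs in Omega. If the flat disc of points
x + zeta e with |zeta| <= rho lies in Omega, then g_j(x)(e, e) <= 2 / (K rho^2), by the lemma
of Ahlfors ([schwarz_disc]). Indeed the energy u(zeta) = g_j(x + zeta e)(e, e) satisfies
Delta log u >= 4 K u ([curvature_energy]), a consequence of the formula for the Chern
curvature and of the Cauchy-Schwarz inequality; at a maximum of u (rho^2 - |zeta|^2)^2 the
second derivative test gives the opposite estimate ([weighted_max]).

Near p the domain is given by r < 0, with r of class C^2 and dr <> 0. For x in Omega close to
p the number s = - r(x) is at least a constant times delta(x), and Omega contains a disc of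
radius of order s centred at x in one coordinate direction e_i0, as well as discs of radius of
order sqrt s in m - 1 directions that are complex tangent to the level set of r
([boundary_discs]): in the tangent directions r varies only at second order. The m directions
form a frame of determinant one, so that a Hadamard inequality ([posdef_det_le]) bounds
det g_j(x) by a constant times the product of the m energies, that is, by a constant times
s^-2 s^-(m-1) = s^-(m+1), and this is at most a constant times delta(x)^-(m+1).

Since the classes C^n of functions on C^m are defined by iterated derivatives along real
lines with fixed directions, the calculus below is based on such derivatives; the one fact
that needs proof is their additivity in the direction ([is_rdir_addv]), which makes the
Wirtinger derivatives available ([sum_dz], [sum_dzbar]). *)

Local Notation "t **: v" := (((t%:C)%C : Cx _) *: v)
  (at level 40, left associativity).

(** * Complex numbers and real-valued norms *)

Section ComplexNumbers.
Context (R : realType).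
Implicit Types (x y z : Cx R) (t : R).

Lemma cReD x y : complex.Re (x + y) = complex.Re x + complex.Re y.
Proof. by case: x; case: y. Qed.

Lemma cImD x y : complex.Im (x + y) = complex.Im x + complex.Im y.
Proof. by case: x; case: y. Qed.

Lemma cReN x : complex.Re (- x) = - complex.Re x.
Proof. by case: x. Qed.

Lemma cImN x : complex.Im (- x) = - complex.Im x.
Proof. by case: x. Qed.

Lemma cReM x y : complex.Re (x * y) =
  complex.Re x * complex.Re y - complex.Im x * complex.Im y.
Proof. by case: x; case: y. Qed.

Lemma cImM x y : complex.Im (x * y) =
  complex.Re x * complex.Im y + complex.Im x * complex.Re y.
Proof. by case: x => a b; case: y => c d /=. Qed.

Lemma cRe_conj x : complex.Re x^* = complex.Re x.
Proof. by case: x. Qed.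

Lemma cIm_conj x : complex.Im x^* = - complex.Im x.
Proof. by case: x. Qed.

Lemma cRe_i : complex.Re ('i : Cx R) = 0.
Proof. by []. Qed.

Lemma cIm_i : complex.Im ('i : Cx R) = 1.
Proof. by []. Qed.

Definition cReIm := (cReD, cImD, cReN, cImN, cReM, cImM, cRe_conj, cIm_conj,
  cRe_i, cIm_i).

Lemma cx_eqP x y : complex.Re x = complex.Re y ->
  complex.Im x = complex.Im y -> x = y.
Proof. by case: x => a b; case: y => c d /= -> ->. Qed.

Lemma cabsE x : cabs x = Num.sqrt (complex.Re x ^+ 2 + complex.Im x ^+ 2).
Proof. by rewrite /cabs (normc_def x). Qed.

Lemma cabs_norm x : `|x| = ((cabs x)%:C)%C.
Proof. by rewrite cabsE (normc_def x). Qed.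

Lemma cabs_ge0 x : 0 <= cabs x.
Proof. by rewrite cabsE sqrtr_ge0. Qed.

Lemma cabs_sqr x : cabs x ^+ 2 = complex.Re x ^+ 2 + complex.Im x ^+ 2.
Proof. by rewrite cabsE sqr_sqrtr // addr_ge0 // sqr_ge0. Qed.

Lemma cabsM x y : cabs (x * y) = cabs x * cabs y.
Proof. by rewrite /cabs normrM [`|x|]cabs_norm [`|y|]cabs_norm /= mul0r subr0. Qed.

Lemma cabsD x y : cabs (x + y) <= cabs x + cabs y.
Proof.
have := ler_normD x y; rewrite !cabs_norm lecE => /andP[_].
by rewrite cReD.
Qed.

Lemma cabsN x : cabs (- x) = cabs x.
Proof. by rewrite /cabs normrN. Qed.

Lemma cabs0 : cabs (0 : Cx R) = 0.
Proof. by rewrite /cabs normr0. Qed.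

Lemma cabs1 : cabs (1 : Cx R) = 1.
Proof. by rewrite /cabs normr1. Qed.

Lemma cabs_eq0 x : cabs x = 0 -> x = 0.
Proof. by move=> h; apply/eqP; rewrite -normr_eq0 cabs_norm h. Qed.

Lemma cabs_gt0 x : x != 0 -> 0 < cabs x.
Proof.
by move=> x0; rewrite lt_def cabs_ge0 andbT; apply: contra x0 => /eqP/cabs_eq0->.
Qed.

Lemma cabs_conj x : cabs x^* = cabs x.
Proof. by rewrite /cabs norm_conjC. Qed.

Lemma cabs_real t : cabs ((t%:C)%C : Cx R) = `|t|.
Proof. by rewrite cabsE /= expr0n addr0 sqrtr_sqr. Qed.

Lemma cabsV x : cabs x^-1 = (cabs x)^-1.
Proof.
have [->|x0] := eqVneq x 0; first by rewrite invr0 cabs0 invr0.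
have c0 := lt0r_neq0 (cabs_gt0 x0).
by apply: (mulfI c0); rewrite -cabsM !divff ?cabs1.
Qed.

Lemma cRe_le x : `|complex.Re x| <= cabs x.
Proof.
by rewrite cabsE -sqrtr_sqr ler_wsqrtr // lerDl sqr_ge0.
Qed.

Lemma cIm_le x : `|complex.Im x| <= cabs x.
Proof. by rewrite cabsE -sqrtr_sqr ler_wsqrtr // lerDr sqr_ge0. Qed.

Lemma cabs_le x : cabs x <= `|complex.Re x| + `|complex.Im x|.
Proof.
rewrite cabsE; set a := complex.Re x; set b := complex.Im x.
have h : 0 <= `|a| + `|b| by rewrite addr_ge0.
rewrite -(ger0_norm h) -(sqrtr_sqr (`|a| + `|b|)) ler_wsqrtr //.
rewrite sqrrD !real_normK ?num_real// addrAC lerDl.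
by rewrite mulrn_wge0 // mulr_ge0.
Qed.

Lemma cabs_sum (I : Type) (r : seq I) (P : pred I) (F : I -> Cx R) :
  cabs (\sum_(i <- r | P i) F i) <= \sum_(i <- r | P i) cabs (F i).
Proof.
elim/big_ind2 : _ => [|x1 x2 y1 y2 h1 h2|//]; first by rewrite cabs0.
by apply: le_trans (cabsD _ _) _; rewrite lerD.
Qed.

Lemma cabs_prod (I : Type) (r : seq I) (P : pred I) (F : I -> Cx R) :
  cabs (\prod_(i <- r | P i) F i) = \prod_(i <- r | P i) cabs (F i).
Proof. by apply: (big_morph (@cabs R) cabsM cabs1). Qed.

Lemma cRe_real t : complex.Re ((t%:C)%C : Cx R) = t. Proof. by []. Qed.
Lemma cIm_real t : complex.Im ((t%:C)%C : Cx R) = 0. Proof. by []. Qed.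

End ComplexNumbers.

Section RealNorm.
Context (R : realType) (W : normedModType (Cx R)).
Implicit Types (v w z : W).

(** The norm of a space normed over [Cx R] takes its values in [Cx R]; [rnorm] is
the same norm as a real number, so that estimates can be made in [R]. *)
Definition rnorm v : R := complex.Re `|v|.

Lemma rnormE v : `|v| = ((rnorm v)%:C)%C.
Proof.
have : (0 : Cx R) <= `|v| by rewrite normr_ge0.
rewrite lecE /= => /andP[/eqP h _]; apply: cx_eqP => //=.
Qed.

Lemma rnorm_ge0 v : 0 <= rnorm v.
Proof. by have := normr_ge0 v; rewrite lecE /= => /andP[_]. Qed.

Lemma rnormD v w : rnorm (v + w) <= rnorm v + rnorm w.
Proof.
have := ler_normD v w; rewrite !rnormE lecE => /andP[_].
by rewrite cReD.
Qed.

Lemma rnormN v : rnorm (- v) = rnorm v.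
Proof. by rewrite /rnorm normrN. Qed.

Lemma rnorm0 : rnorm (0 : W) = 0.
Proof. by rewrite /rnorm normr0. Qed.

Lemma rnormZ (a : Cx R) v : rnorm (a *: v) = cabs a * rnorm v.
Proof. by rewrite /rnorm normrZ cabs_norm rnormE cReM /= mul0r subr0. Qed.

(** A radius in [Cx R] that is positive for the order of [Cx R] is real, hence real
radii are enough. *)
Lemma nbhs_rnorm z (P : set W) :
  nbhs z P <-> exists2 r : R, 0 < r & forall w, rnorm (w - z) < r -> P w.
Proof.
split.
- move=> /nbhs_ballP[e /=]; rewrite ltcE => /andP[/eqP ie re] h.
  exists (complex.Re e) => // w hw; apply: h.
  rewrite -ball_normE /ball_ /= -normrN opprB rnormE ltcE /= ie eqxx /=.
  exact: hw.
- case=> r r0 h; apply/nbhs_ballP; exists ((r%:C)%C : Cx R).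
    by rewrite /= ltcR.
  move=> w; rewrite -ball_normE /ball_ /= -normrN opprB rnormE ltcR.
  exact: h.
Qed.

End RealNorm.

(** * Real directional derivatives *)

Section DirectionalCalculus.
Context (R : realType).

(** The form of differentiability that survives the passage to complex values and
to variable base points. *)
Lemma is_derive_eps (f : R -> R) (a d : R) :
  is_derive a 1 f d <->
  forall e : R, 0 < e -> exists2 r : R, 0 < r &
    forall t : R, `|t| < r -> `|f (a + t) - f a - d * t| <= e * `|t|.
Proof.
have scaleE (x y : R) : x *: y = x * y by [].
split.
- move=> fd e e0.
  have df : derivable f a 1 by case: fd.
  have vf : 'D_1 f a = d by case: fd.
  have := df; rewrite /derivable => /cvg_ex [l hl].
  have ld : l = d by rewrite -vf; apply/esym/cvg_lim.
  move: hl; rewrite ld => /cvgrPdist_lt /(_ e e0).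
  rewrite near_withinE => /nbhs_ballP[r /= r0 hr].
  exists r => // t tr; have [->|t0] := eqVneq t 0.
    by rewrite addr0 subrr mulr0 subr0 normr0 mulr0.
  have := hr t; rewrite /ball /= sub0r normrN => /(_ tr t0) /ltW.
  rewrite -(ler_pM2r (_ : 0 < `|t|)) ?normr_gt0 // -normrM; apply: le_trans.
  rewrite -normrN scaler1 [t + a]addrC scaleE.
  by rewrite [X in _ <= `|X|](_ : _ = d * t - (f (a + t) - f a)) ?opprB //; field.
- move=> h.
  have hl : (fun t => t^-1 *: ((f \o shift a) (t *: (1:R)) - f a)) @ 0^' --> d.
    apply/cvgrPdist_le => e e0; rewrite near_withinE.
    have [r r0 hr] := h e e0; apply/nbhs_ballP; exists r => //= t.
    rewrite /ball /= sub0r normrN => tr t0.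
    rewrite -(ler_pM2r (_ : 0 < `|t|)) ?normr_gt0 // -normrM.
    apply: le_trans (hr t tr); rewrite -normrN /= scaler1 [t + a]addrC scaleE.
    by rewrite [X in `|X|](_ : _ = f (a + t) - f a - d * t) //; field.
  split; first by apply/cvg_ex; exists d.
  exact: cvg_lim.
Qed.

Context (m : nat).
Local Notation V := 'rV[Cx R]_m.
Implicit Types (F G : V -> Cx R) (u v w z : V) (t e : R) (U : set V).

Lemma for_continuous_rnorm F z : {for z, continuous F} <->
  forall e, 0 < e -> exists2 r : R, 0 < r &
    forall w, rnorm (w - z) < r -> cabs (F w - F z) < e.
Proof.
split.
- move=> cF e e0.
  have /cF /nbhs_rnorm[r r0 h] : nbhs (F z) [set y | cabs (y - F z) < e].
    by apply/nbhs_rnorm; exists e.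
  by exists r.
- move=> h P /nbhs_rnorm[e e0 he].
  have [r r0 hr] := h e e0; apply/nbhs_rnorm; exists r => // w /hr.
  exact: he.
Qed.

Lemma open_rnorm U z : open U -> U z -> exists2 r : R, 0 < r &
  forall w, rnorm (w - z) < r -> U w.
Proof. by move=> oU Uz; apply/nbhs_rnorm/open_nbhs_nbhs. Qed.

Lemma rnorm_scale t v : rnorm (t **: v) = `|t| * rnorm v.
Proof. by rewrite rnormZ cabs_real. Qed.

(** An estimate on complex values, so that it passes to complex linear combinations
without separating real and imaginary parts. *)
Definition is_rdir v F z (d : Cx R) := forall e, 0 < e ->
  exists2 r : R, 0 < r & forall t, `|t| < r ->
    cabs (F (z + t **: v) - F z - ((t%:C)%C : Cx R) * d) <= e * `|t|.

Lemma cast_addv z v s t : z + s **: v + t **: v = z + (s + t) **: v.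
Proof. by rewrite -addrA -scalerDl -(rmorphD (real_complex R)). Qed.

Lemma is_rdir_derive_Re v F z t d : is_rdir v F (z + t **: v) d ->
  is_derive t 1 (fun s => complex.Re (F (z + s **: v))) (complex.Re d).
Proof.
move=> h; apply/is_derive_eps => e /h[r r0 hr]; exists r => // s /hr; rewrite cast_addv.
apply: le_trans; apply: le_trans (cRe_le _).
by rewrite !cReIm /= mul0r subr0 [s * _]mulrC.
Qed.

Lemma is_rdir_derive_Im v F z t d : is_rdir v F (z + t **: v) d ->
  is_derive t 1 (fun s => complex.Im (F (z + s **: v))) (complex.Im d).
Proof.
move=> h; apply/is_derive_eps => e /h[r r0 hr]; exists r => // s /hr; rewrite cast_addv.
apply: le_trans; apply: le_trans (cIm_le _).
by rewrite !cReIm /= mul0r addr0 [s * _]mulrC.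
Qed.

(** Links the epsilon-delta form with the real and imaginary parts in terms of which
[rdir] is defined. *)
Lemma is_rdirP v F z d : is_rdir v F z d <->
  rderivable (line F z v) 0 /\ rdir v F z = d.
Proof.
split.
- move=> h; have h' : is_rdir v F (z + (0 : R) **: v) d by rewrite scale0r addr0.
  have re := is_rdir_derive_Re h'; have im := is_rdir_derive_Im h'.
  split; first by split; [case: re|case: im].
  by apply: cx_eqP; rewrite /= derive1E; [case: re|case: im].
- case=> [[dre dim]] <- e e0.
  have e2 : 0 < e / 2 by rewrite divr_gt0.
  have /is_derive_eps/(_ _ e2)[r1 r10 h1] : is_derive (0:R) 1
    (fun s => complex.Re (F (z + s **: v))) (complex.Re (rdir v F z)).
    by split; [exact: dre | rewrite /= derive1E].
  have /is_derive_eps/(_ _ e2)[r2 r20 h2] : is_derive (0:R) 1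
    (fun s => complex.Im (F (z + s **: v))) (complex.Im (rdir v F z)).
    by split; [exact: dim | rewrite /= derive1E].
  exists (Num.min r1 r2); first by rewrite lt_min r10.
  move=> t; rewrite lt_min => /andP[/h1 {}h1 /h2 {}h2].
  apply: le_trans (cabs_le _) _; rewrite !cReIm cRe_real cIm_real.
  move: h1 h2; rewrite !scale0r !addr0 !add0r !mul0r subr0 addr0.
  by rewrite ![t * _]mulrC => h1 h2; rewrite (splitr e) mulrDl; exact: lerD.
Qed.

Lemma is_rdirD v F G z d d' : is_rdir v F z d -> is_rdir v G z d' ->
  is_rdir v (fun w => F w + G w) z (d + d').
Proof.
move=> hF hG e e0; have e2 : 0 < e / 2 by rewrite divr_gt0.
have [r1 r10 h1] := hF _ e2; have [r2 r20 h2] := hG _ e2.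
exists (Num.min r1 r2); first by rewrite lt_min r10.
move=> t; rewrite lt_min => /andP[/h1 {}h1 /h2 {}h2].
rewrite [X in cabs X](_ : _ = (F (z + t **: v) - F z - ((t%:C)%C : Cx R) * d) +
  (G (z + t **: v) - G z - ((t%:C)%C : Cx R) * d')); last by ring.
apply: le_trans (cabsD _ _) _; lra.
Qed.

Lemma is_rdirM v F z d (c : Cx R) : is_rdir v F z d ->
  is_rdir v (fun w => c * F w) z (c * d).
Proof.
move=> hF e e0; have c0 : 0 < cabs c + 1 by have := cabs_ge0 c; lra.
have e2 : 0 < e / (cabs c + 1) by rewrite divr_gt0.
have [r r0 h] := hF _ e2; exists r => // t /h {}h.
rewrite [X in cabs X](_ : _ = c * (F (z + t **: v) - F z - ((t%:C)%C : Cx R) * d));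
  last by ring.
rewrite cabsM; apply: le_trans (_ : (cabs c + 1) * (e / (cabs c + 1) * `|t|) <= _).
  by apply: ler_pM => //; rewrite ?cabs_ge0 // lerDl.
by rewrite mulrA mulrCA divff ?mulr1 // gt_eqF.
Qed.

Lemma is_rdir_cst v z (c : Cx R) : is_rdir v (fun=> c) z 0.
Proof.
move=> e e0; exists 1 => // t _.
by rewrite subrr mulr0 subr0 cabs0 mulr_ge0 // ltW.
Qed.

Lemma is_rdir_sum v z (I : Type) (r : seq I) (F : I -> V -> Cx R)
    (d : I -> Cx R) : (forall i, is_rdir v (F i) z (d i)) ->
  is_rdir v (fun w => \sum_(i <- r) F i w) z (\sum_(i <- r) d i).
Proof.
move=> h; elim: r => [|i r IH].
  have -> : (fun w : V => \sum_(i <- [::]) F i w) = (fun=> 0).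
    by apply/funext => w; rewrite big_nil.
  by rewrite big_nil; apply: is_rdir_cst.
have -> : (fun w : V => \sum_(j <- i :: r) F j w) =
    (fun w => F i w + \sum_(j <- r) F j w).
  by apply/funext => w; rewrite big_cons.
by rewrite big_cons; apply: is_rdirD.
Qed.

Lemma open_line U z v : open U -> U z ->
  exists2 r : R, 0 < r & forall t, `|t| < r -> U (z + t **: v).
Proof.
move=> oU Uz; have [r r0 h] := open_rnorm oU Uz.
have n0 : 0 < rnorm v + 1 by have := rnorm_ge0 v; lra.
exists (r / (rnorm v + 1)); first by rewrite divr_gt0.
move=> t; rewrite ltr_pdivlMr // => tr; apply: h.
rewrite addrC addKr rnorm_scale; apply: le_lt_trans tr.
by rewrite ler_wpM2l // lerDl.
Qed.

Lemma is_rdir_ext U v F G z d : open U -> U z -> (forall w, U w -> F w = G w) ->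
  is_rdir v F z d -> is_rdir v G z d.
Proof.
move=> oU Uz FG h e /h[r r0 hr]; have [r' r'0 h'] := open_line v oU Uz.
exists (Num.min r r'); first by rewrite lt_min r0.
move=> t; rewrite lt_min => /andP[/hr + /h' Ut].
by rewrite !FG.
Qed.

Lemma is_rdir_scale v F z d t : is_rdir v F z d ->
  is_rdir (t **: v) F z (((t%:C)%C : Cx R) * d).
Proof.
move=> h e e0; have t0 : 0 < `|t| + 1 by have := normr_ge0 t; lra.
have [|r r0 hr] := h (e / (`|t| + 1)); first by rewrite divr_gt0.
exists (r / (`|t| + 1)); first by rewrite divr_gt0.
move=> s; rewrite ltr_pdivlMr // => sr.
have /hr : `|s * t| < r.
  by apply: le_lt_trans sr; rewrite normrM ler_wpM2l // lerDl.
rewrite scalerA -(rmorphM (real_complex R)) mulrA -(rmorphM (real_complex R)).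
move/le_trans; apply; rewrite normrM mulrC [leRHS]mulrC -mulrA ler_wpM2l //.
by rewrite mulrA ler_pdivrMr // mulrC ler_wpM2l ?ltW // ltrDl.
Qed.

Lemma mvt_Re F w v (d : V -> Cx R) :
  (forall s : R, 0 <= s <= 1 -> is_rdir v F (w + s **: v) (d (w + s **: v))) ->
  exists2 s : R, 0 <= s <= 1 &
    complex.Re (F (w + v) - F w) = complex.Re (d (w + s **: v)).
Proof.
move=> h.
have dr (s : R) : 0 <= s <= 1 -> is_derive s 1 (fun s => complex.Re (F (w + s **: v)))
    (complex.Re (d (w + s **: v))).
  by move=> s01; apply: is_rdir_derive_Re; apply: h.
have [|||s s01 E] := @MVT R (fun s => complex.Re (F (w + s **: v)))
    (fun s => complex.Re (d (w + s **: v))) 0 1.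
- exact: ltr01.
- by move=> s; rewrite in_itv /= => /andP[s0 s1]; apply: dr; rewrite !ltW.
- apply: derivable_within_continuous => s; rewrite in_itv /= => s01.
  by case: (dr s s01).
exists s; first by move: s01; rewrite in_itv /= => /andP[? ?]; rewrite !ltW.
by move: E; rewrite subr0 mulr1 scale0r addr0 scale1r cReD cReN.
Qed.

(** The mean value theorem fails for complex values, but applying it to the real and
imaginary parts (the latter being the real part of [- i F]) costs a factor 2 only. *)
Lemma mvt_cabs F w v (d : V -> Cx R) (c : Cx R) e :
  (forall s : R, 0 <= s <= 1 -> is_rdir v F (w + s **: v) (d (w + s **: v)) /\
     cabs (d (w + s **: v) - c) <= e) ->
  cabs (F (w + v) - F w - c) <= e + e.
Proof.
move=> h.
have [s s01 Es] := mvt_Re (fun (s : R) s01 => (h s s01).1).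
have h' (t : R) : 0 <= t <= 1 -> is_rdir v (fun w => - 'i * F w) (w + t **: v)
    ((fun w => - 'i * d w) (w + t **: v)).
  by move=> t01; apply: is_rdirM; exact: (h t t01).1.
have [t t01 Et] := mvt_Re (d := fun w => - 'i * d w) h'.
apply: le_trans (cabs_le _) _; apply: lerD.
  apply: le_trans (h s s01).2; apply: le_trans (cRe_le _).
  by rewrite cReD Es -cReD.
apply: le_trans (h t t01).2; apply: le_trans (cIm_le _).
have Ei : complex.Im (F (w + v) - F w) = complex.Im (d (w + t **: v)).
  by move: Et; rewrite !cReIm oppr0 !mul0r !sub0r !mulN1r !opprK.
by rewrite cImD Ei -cImD.
Qed.

(** Moving first by [t u] and then by [t v], the second increment is [t dv z] up to
[o(t)], by the mean value inequality and the continuity of [dv] at [z]. *)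
Lemma is_rdir_addv U F z u v (du dv : V -> Cx R) : open U -> U z ->
  (forall w, U w -> is_rdir u F w (du w)) ->
  (forall w, U w -> is_rdir v F w (dv w)) ->
  {for z, continuous dv} ->
  is_rdir (u + v) F z (du z + dv z).
Proof.
move=> oU Uz hu hv /for_continuous_rnorm cv e e0.
have e4 : 0 < e / 4 by lra.
have e2 : 0 < e / 2 by lra.
have [r1 r10 h1] := hu z Uz _ e2.
have [r2 r20 h2] := cv _ e4.
have [r3 r30 h3] := open_rnorm oU Uz.
have n0 : 0 < rnorm u + rnorm v + 1.
  by have := rnorm_ge0 v; have := rnorm_ge0 u; lra.
pose r := Num.min r1 (Num.min r2 r3 / (rnorm u + rnorm v + 1)).
exists r; first by rewrite lt_min r10 divr_gt0 // lt_min r20.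
move=> t; rewrite /r lt_min ltr_pdivlMr // lt_min => /andP[tr1 /andP[tr2 tr3]].
have {}h1 := h1 t tr1.
have near (s : R) : 0 <= s <= 1 -> rnorm (z + t **: u + s **: (t **: v) - z) <=
    `|t| * (rnorm u + rnorm v + 1).
  move=> /andP[s0 s1]; rewrite [X in rnorm X](_ : _ = t **: u + s **: (t **: v)); last first.
    by rewrite -[z + _ + _]addrA [z + _]addrC addrK.
  apply: le_trans (rnormD _ _) _; rewrite !rnorm_scale.
  have := rnorm_ge0 v; have := normr_ge0 t; rewrite (ger0_norm s0) => t0 v0.
  have : s * (`|t| * rnorm v) <= `|t| * rnorm v.
    by rewrite ler_piMl // mulr_ge0.
  lra.
have key : cabs (F (z + t **: u + t **: v) - F (z + t **: u) - ((t%:C)%C : Cx R) * dv z)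
    <= `|t| * (e / 4) + `|t| * (e / 4).
  apply: (mvt_cabs (d := fun w => ((t%:C)%C : Cx R) * dv w)) => s s01; split.
    apply: is_rdir_scale; apply: hv; apply: h3.
    exact: le_lt_trans (near s s01) tr3.
  rewrite -mulrBr cabsM cabs_real ler_wpM2l // ltW //; apply: h2.
  exact: le_lt_trans (near s s01) tr2.
rewrite scalerDr addrA.
rewrite [X in cabs X](_ : _ =
  (F (z + t **: u + t **: v) - F (z + t **: u) - ((t%:C)%C : Cx R) * dv z) +
  (F (z + t **: u) - F z - ((t%:C)%C : Cx R) * du z)); last by ring.
apply: le_trans (cabsD _ _) _; lra.
Qed.

End DirectionalCalculus.

(** * Functions of class C^n and Wirtinger derivatives *)

Section SmoothFunctions.
Context (R : realType) (m : nat).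
Local Notation V := 'rV[Cx R]_m.
Implicit Types (F G : V -> Cx R) (u v w z : V) (t e : R) (U : set V).

Lemma rdirE v F z d : is_rdir v F z d -> rdir v F z = d.
Proof. by move/is_rdirP => []. Qed.

Lemma classC_continuous n U F z : classC n U F -> U z -> {for z, continuous F}.
Proof. by case: n => [|n] [h _] /h. Qed.

Lemma classC_is_rdir n U F z v : classC n.+1 U F -> U z ->
  is_rdir v F z (rdir v F z).
Proof. by case=> _ h Uz; apply/is_rdirP; split=> //; apply: (h v).1. Qed.

Lemma classC_rdir n U F v : classC n.+1 U F -> classC n U (rdir v F).
Proof. by case=> _ h; apply: (h v).2. Qed.

Lemma classCW n U F : classC n.+1 U F -> classC n U F.
Proof.
elim: n F => [|n IH] F [h1 h2]; first by split.
by split=> // v; split; [exact: (h2 v).1 | apply/IH/(h2 v).2].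
Qed.

Lemma for_continuous_ext U F G z : open U -> U z -> (forall w, U w -> F w = G w) ->
  {for z, continuous F} -> {for z, continuous G}.
Proof.
move=> oU Uz FG /for_continuous_rnorm cF; apply/for_continuous_rnorm => e /cF[r r0 h].
have [r' r'0 h'] := open_rnorm oU Uz; exists (Num.min r r').
  by rewrite lt_min r0.
by move=> w; rewrite lt_min => /andP[/h + /h' Uw]; rewrite !FG.
Qed.

Lemma classC_ext n U F G : open U -> (forall w, U w -> F w = G w) ->
  classC n U F -> classC n U G.
Proof.
move=> oU; elim: n F G => [|n IH] F G FG cF.
  by split=> // z Uz; apply: for_continuous_ext FG (classC_continuous cF Uz).
have rG v z : U z -> is_rdir v G z (rdir v F z).
  by move=> Uz; apply: is_rdir_ext FG _ => //; apply: classC_is_rdir cF Uz.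
split=> [z Uz|v]; first exact: for_continuous_ext FG (classC_continuous cF Uz).
split=> [z Uz|]; first by have /is_rdirP[] := rG v z Uz.
apply: IH (classC_rdir v cF) => z Uz.
by rewrite (rdirE (rG v z Uz)).
Qed.

Lemma classCD n U F G : open U -> classC n U F -> classC n U G ->
  classC n U (fun w => F w + G w).
Proof.
move=> oU; elim: n F G => [|n IH] F G cF cG.
  split=> // z Uz.
  exact: (cvgD (classC_continuous cF Uz) (classC_continuous cG Uz)).
have r v z : U z -> is_rdir v (fun w => F w + G w) z (rdir v F z + rdir v G z).
  by move=> Uz; apply: is_rdirD; [apply: classC_is_rdir cF Uz|apply: classC_is_rdir cG Uz].
split=> [z Uz|v].
  exact: (cvgD (classC_continuous cF Uz) (classC_continuous cG Uz)).
split=> [z Uz|]; first by have /is_rdirP[] := r v z Uz.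
apply: classC_ext (IH _ _ (classC_rdir v cF) (classC_rdir v cG)) => // z Uz.
by rewrite (rdirE (r v z Uz)).
Qed.

Lemma for_continuousM F z (c : Cx R) : {for z, continuous F} ->
  {for z, continuous (fun w => c * F w)}.
Proof.
move=> /for_continuous_rnorm cF; apply/for_continuous_rnorm => e e0.
have c0 : 0 < cabs c + 1 by have := cabs_ge0 c; lra.
have [|r r0 h] := cF (e / (cabs c + 1)); first by rewrite divr_gt0.
exists r => // w /h; rewrite -mulrBr cabsM ltr_pdivlMr //; apply: le_lt_trans.
by rewrite mulrC ler_wpM2l ?cabs_ge0 // lerDl.
Qed.

Lemma classCM n U F (c : Cx R) : open U -> classC n U F ->
  classC n U (fun w => c * F w).
Proof.
move=> oU; elim: n F => [|n IH] F cF.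
  by split=> // z Uz; apply: for_continuousM; apply: classC_continuous cF Uz.
have r v z : U z -> is_rdir v (fun w => c * F w) z (c * rdir v F z).
  by move=> Uz; apply: is_rdirM; apply: classC_is_rdir cF Uz.
split=> [z Uz|v]; first by apply: for_continuousM; apply: classC_continuous cF Uz.
split=> [z Uz|]; first by have /is_rdirP[] := r v z Uz.
apply: classC_ext (IH _ (classC_rdir v cF)) => // z Uz.
by rewrite (rdirE (r v z Uz)).
Qed.

Lemma classC_cst n U (c : Cx R) : open U -> classC n U (fun=> c).
Proof.
have cc (z : V) (a : Cx R) : {for z, continuous (fun=> a)}.
  by apply/for_continuous_rnorm => e e0; exists 1 => // w _; rewrite subrr cabs0.
move=> oU; elim: n c => [|n IH] c; first by split=> // z _; exact: cc.
split=> [z _|v]; first exact: cc.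
split=> [z _|]; first by have /is_rdirP[] := is_rdir_cst v z c.
by apply: classC_ext (IH 0) => // z _; rewrite (rdirE (is_rdir_cst v z c)).
Qed.

Lemma classC_sum n U (I : Type) (r : seq I) (F : I -> V -> Cx R) : open U ->
  (forall i, classC n U (F i)) -> classC n U (fun w => \sum_(i <- r) F i w).
Proof.
move=> oU h; elim: r => [|i r IH].
  by apply: (classC_ext oU _ (classC_cst n 0 oU)) => w _; rewrite big_nil.
by apply: (classC_ext oU _ (classCD oU (h i) IH)) => w _; rewrite big_cons.
Qed.

Lemma is_rdir_conj v F z d : is_rdir v F z d ->
  is_rdir v (fun w => (F w)^*) z d^*.
Proof.
move=> h e /h[r r0 hr]; exists r => // t /hr.
rewrite -[X in X <= _]cabs_conj !rmorphB rmorphM /=.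
have -> // : ((t%:C)%C : Cx R)^* = (t%:C)%C.
by apply: cx_eqP; rewrite ?cRe_conj // cIm_conj /= oppr0.
Qed.

Section Linear.
Context (U : set V) (F : V -> Cx R) (z : V).
Context (oU : open U) (Uz : U z) (cF : classC 1 U F).

Lemma rdir_addv u v : rdir (u + v) F z = rdir u F z + rdir v F z.
Proof.
apply: rdirE; apply: (is_rdir_addv (du := rdir u F) oU Uz).
- by move=> w Uw; apply: classC_is_rdir cF Uw.
- by move=> w Uw; apply: classC_is_rdir cF Uw.
- exact: classC_continuous (classC_rdir v cF) Uz.
Qed.

Lemma rdir_scalev t v : rdir (t **: v) F z = ((t%:C)%C : Cx R) * rdir v F z.
Proof. by apply/rdirE/is_rdir_scale; apply: classC_is_rdir cF Uz. Qed.

Lemma scale_cxE (a : Cx R) v :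
  a *: v = complex.Re a **: v + complex.Im a **: ('i *: v).
Proof.
rewrite scalerA -scalerDl; congr (_ *: _).
by apply: cx_eqP; rewrite !cReIm /=; ring.
Qed.

Lemma rdir_cx (a : Cx R) v : rdir (a *: v) F z =
  ((complex.Re a)%:C)%C * rdir v F z + ((complex.Im a)%:C)%C * rdir ('i *: v) F z.
Proof. by rewrite scale_cxE rdir_addv !rdir_scalev. Qed.

Lemma rdir0 : rdir 0 F z = 0.
Proof. by rewrite -(scale0r 0) (rdir_scalev 0) mul0r. Qed.

Lemma rdir_sumv (I : Type) (r : seq I) (v : I -> V) :
  rdir (\sum_(i <- r) v i) F z = \sum_(i <- r) rdir (v i) F z.
Proof. exact: (big_morph (fun v => rdir v F z) rdir_addv rdir0). Qed.

Lemma evec_sum v : v = \sum_k v 0 k *: evec R k.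
Proof. by rewrite {1}(row_sum_delta v). Qed.

(** Both sides are the complex linear part of [v |-> rdir v F z]; expanding [v] in
the coordinate vectors reduces the identity to complex multiples of one of them. *)
Lemma sum_dz v : \sum_k v 0 k * dz k F z =
  (rdir v F z - 'i * rdir ('i *: v) F z) / 2.
Proof.
rewrite [in RHS](evec_sum v) scaler_sumr !rdir_sumv mulr_sumr -sumrB mulr_suml.
apply: eq_bigr => k _; rewrite /dz scalerA (rdir_cx (v 0 k)) (rdir_cx ('i * v 0 k)).
have -> : complex.Re ('i * v 0 k) = - complex.Im (v 0 k) by rewrite !cReIm; ring.
have -> : complex.Im ('i * v 0 k) = complex.Re (v 0 k) by rewrite !cReIm; ring.
rewrite {1}(_ : v 0 k = ((complex.Re (v 0 k))%:C)%C + 'i * ((complex.Im (v 0 k))%:C)%C).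
  rewrite (rmorphN (real_complex R)) /=.
  set a : Cx R := (_%:C)%C; set b : Cx R := (_%:C)%C.
  set A := rdir _ F z; set B := rdir _ F z.
  rewrite mulrA -[RHS](_ : ((a + 'i * b) * (A - 'i * B)) / 2 = _) //.
  congr (_ / 2); have := sqrCi (Cx R); rewrite expr2 => ii.
  transitivity (a * A - 'i * (a * B) + 'i * (b * A) - ('i * 'i) * (b * B)); first by ring.
  by rewrite ii; ring.
by apply: cx_eqP; rewrite !cReIm /=; ring.
Qed.

Lemma sum_dzbar v : \sum_k (v 0 k)^* * dzbar k F z =
  (rdir v F z + 'i * rdir ('i *: v) F z) / 2.
Proof.
rewrite [in RHS](evec_sum v) scaler_sumr !rdir_sumv mulr_sumr -big_split mulr_suml.
apply: eq_bigr => k _; rewrite /dzbar scalerA (rdir_cx (v 0 k)) (rdir_cx ('i * v 0 k)).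
have -> : complex.Re ('i * v 0 k) = - complex.Im (v 0 k) by rewrite !cReIm; ring.
have -> : complex.Im ('i * v 0 k) = complex.Re (v 0 k) by rewrite !cReIm; ring.
rewrite {1}(_ : (v 0 k)^* = ((complex.Re (v 0 k))%:C)%C - 'i * ((complex.Im (v 0 k))%:C)%C).
  rewrite (rmorphN (real_complex R)) /=.
  set a : Cx R := (_%:C)%C; set b : Cx R := (_%:C)%C.
  set A := rdir _ F z; set B := rdir _ F z.
  rewrite mulrA -[RHS](_ : ((a - 'i * b) * (A + 'i * B)) / 2 = _) //.
  congr (_ / 2); have := sqrCi (Cx R); rewrite expr2 => ii.
  transitivity (a * A + 'i * (a * B) - 'i * (b * A) - ('i * 'i) * (b * B)); first by ring.
  by rewrite ii; ring.
by apply: cx_eqP; rewrite !cReIm /=; ring.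
Qed.

Lemma Im_rdir v : (forall w, U w -> complex.Im (F w) = 0) ->
  complex.Im (rdir v F z) = 0.
Proof.
move=> rF; have h := is_rdir_conj (classC_is_rdir v cF Uz).
have := rdirE (is_rdir_ext oU Uz _ h) => /(_ F) e.
have {}e : rdir v F z = (rdir v F z)^*.
  by apply: e => w Uw; apply: cx_eqP; rewrite !cReIm // rF // oppr0.
by have := congr1 (@complex.Im R) e; rewrite cIm_conj; lra.
Qed.
End Linear.

End SmoothFunctions.

(** * Positive definite Hermitian forms *)

Section HermitianForms.
Context (R : realType) (m : nat).
Implicit Types (A G : 'M[Cx R]_m) (v w : 'rV[Cx R]_m).
Local Open Scope sesquilinear_scope.

Definition posdef G : Prop :=
  G ^t* = G /\ forall v, v != 0 -> 0 < complex.Re (sesq G v v).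

Lemma sesqE A v w : sesq A v w = \sum_i \sum_j v 0 i * (w 0 j)^* * A i j.
Proof.
rewrite /sesq mxE exchange_big /=; apply: eq_bigr => j _; rewrite !mxE mulr_suml.
by apply: eq_bigr => i _; rewrite mulrAC.
Qed.

Lemma sesqDl A v1 v2 w : sesq A (v1 + v2) w = sesq A v1 w + sesq A v2 w.
Proof. by rewrite /sesq !mulmxDl mxE. Qed.

Lemma sesqZl A (a : Cx R) v w : sesq A (a *: v) w = a * sesq A v w.
Proof. by rewrite /sesq -!scalemxAl mxE. Qed.

Lemma sesq0l A w : sesq A 0 w = 0.
Proof. by rewrite /sesq !mul0mx mxE. Qed.

Lemma sesq0r A v : sesq A v 0 = 0.
Proof. by rewrite /sesq mxE big1 // => j _; rewrite !mxE rmorph0 mulr0. Qed.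

Lemma sesq_herm G v w : G ^t* = G -> sesq G w v = (sesq G v w)^*.
Proof.
move=> hG; rewrite !sesqE rmorph_sum exchange_big /=; apply: eq_bigr => i _.
rewrite rmorph_sum; apply: eq_bigr => j _; rewrite !rmorphM /= conjCK.
by rewrite -[in LHS]hG !mxE; ring.
Qed.

Lemma sesqDr G v w1 w2 : G ^t* = G -> sesq G v (w1 + w2) = sesq G v w1 + sesq G v w2.
Proof. by move=> hG; rewrite !(sesq_herm _ v hG) sesqDl rmorphD. Qed.

Lemma sesqZr G (a : Cx R) v w : G ^t* = G -> sesq G v (a *: w) = a^* * sesq G v w.
Proof. by move=> hG; rewrite !(sesq_herm _ v hG) sesqZl rmorphM. Qed.

Lemma sesq_real G v : G ^t* = G -> sesq G v v = ((complex.Re (sesq G v v))%:C)%C.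
Proof.
move=> hG; apply: cx_eqP => //=.
have := congr1 (@complex.Im R) (sesq_herm v v hG); rewrite cIm_conj; lra.
Qed.

Lemma posdef_ge0 G v : posdef G -> 0 <= complex.Re (sesq G v v).
Proof.
move=> [_ h]; have [->|/h/ltW//] := eqVneq v 0.
by rewrite sesq0l.
Qed.

Lemma Re_gram (s : Cx R) (a b : R) :
  complex.Re (((b%:C)%C : Cx R) * ((((b%:C)%C : Cx R))^* * ((a%:C)%C : Cx R) + (- s)^* * s)
    + - s * ((((b%:C)%C : Cx R))^* * s^* + (- s)^* * ((b%:C)%C : Cx R)))
  = b * (a * b - cabs s ^+ 2).
Proof.
case: s => x y; rewrite cabs_sqr /=; ring.
Qed.

(** Expand the form at [b v - s w], where [b] is its value at [w] and [s] its value at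
[(v, w)]. *)
Lemma posdef_cauchy_schwarz G v w : posdef G ->
  cabs (sesq G v w) ^+ 2 <= complex.Re (sesq G v v) * complex.Re (sesq G w w).
Proof.
move=> pG; have [hG pos] := pG; have [->|w0] := eqVneq w 0.
  by rewrite sesq0r cabs0 expr0n mulr_ge0 // posdef_ge0.
have b0 := pos w w0; set b := complex.Re (sesq G w w) in b0 *.
have := posdef_ge0 ((b%:C)%C *: v - sesq G v w *: w) pG.
set s := sesq G v w; set a := complex.Re (sesq G v v).
rewrite sesqDl -!scaleNr !sesqZl !sesqDr // !sesqZr // -/s (sesq_herm v w hG) -/s.
rewrite (sesq_real v hG) (sesq_real w hG) -/a -/b Re_gram.
by rewrite pmulr_rge0 // subr_ge0.
Qed.

Lemma posdef_unit G : posdef G -> G \in unitmx.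
Proof.
move=> [_ pos]; apply: contraT; rewrite -row_free_unit -kermx_eq0 => /rowV0Pn[v].
move=> /sub_kermxP vG v0; have := pos v v0.
by rewrite /sesq vG mul0mx mxE ltxx.
Qed.

(** A Hadamard inequality up to the factor [m!]: after a change of frame the entry
[(k, l)] is at most [sqrt (B k) sqrt (B l)] by Cauchy-Schwarz, so each of the [m!] terms
of the Leibniz formula is at most the product of the [B k]. *)
Lemma posdef_det_le G (P : 'M[Cx R]_m) (B : 'I_m -> R) : posdef G ->
  (forall k, complex.Re (sesq G (row k P) (row k P)) <= B k) ->
  cabs (\det P) ^+ 2 * cabs (\det G) <= (m`!)%:R * \prod_k B k.
Proof.
move=> pG hB.
have B0 k : 0 <= B k by apply: le_trans (posdef_ge0 _ pG) (hB k).
have -> : cabs (\det P) ^+ 2 * cabs (\det G) = cabs (\det (P *m G *m P ^t*)).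
  by rewrite !det_mulmx det_map_mx det_tr !cabsM cabs_conj; ring.
have entry k l : cabs ((P *m G *m P ^t*) k l) <= Num.sqrt (B k) * Num.sqrt (B l).
  have -> : (P *m G *m P ^t*) k l = sesq G (row k P) (row l P).
    rewrite /sesq !mxE; apply: eq_bigr => j _; rewrite !mxE; congr (_ * _).
    by apply: eq_bigr => i _; rewrite !mxE.
  rewrite -sqrtrM // -(ger0_norm (cabs_ge0 _)) -sqrtr_sqr ler_wsqrtr //.
  apply: le_trans (posdef_cauchy_schwarz _ _ pG) _.
  by apply: ler_pM => //; apply: posdef_ge0.
apply: le_trans (cabs_sum _ _ _) _.
rewrite -card_Sn mulr_natl -sumr_const; apply: le_trans (_ : \sum_(s : 'S_m) \prod_k B k <= _).
  apply: ler_sum => s _; rewrite cabsM cabs_prod.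
  have -> : cabs ((-1) ^+ s : Cx R) = 1 by case: (s : bool); rewrite ?expr0 ?expr1 ?cabsN cabs1.
  rewrite mul1r; apply: le_trans (_ : \prod_k (Num.sqrt (B k) * Num.sqrt (B (s k))) <= _).
    by apply: ler_prod => k _; rewrite cabs_ge0 entry.
  have -> : \prod_k (Num.sqrt (B k) * Num.sqrt (B (s k))) = \prod_k B k.
    have e : \prod_k Num.sqrt (B (s k)) = \prod_k Num.sqrt (B k).
      by rewrite [RHS](reindex_inj (@perm_inj _ s)).
    rewrite big_split /= e -big_split /=; apply: eq_bigr => k _.
    by rewrite -expr2 sqr_sqrtr.
  exact: lexx.
by rewrite (eq_bigl (mem [set: 'S_m]%SET)) // => s; rewrite !inE.
Qed.

End HermitianForms.

(** * Curvature and the energy of a constant vector field *)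

Section CurvatureInequality.
Context (R : realType) (m : nat).
Local Notation V := 'rV[Cx R]_m.
Context (D : set V) (g : V -> 'M[Cx R]_m).
Context (oD : open D) (pg : forall z, D z -> posdef (g z))
  (sg : forall i j, classC 2 D (fun z => g z i j)).
Local Open Scope sesquilinear_scope.

Lemma dz_lincomb k (I : Type) (r : seq I) (c : I -> Cx R) (F : I -> V -> Cx R) z :
  D z -> (forall i, classC 1 D (F i)) ->
  dz k (fun w => \sum_(i <- r) c i * F i w) z = \sum_(i <- r) c i * dz k (F i) z.
Proof.
move=> Dz cF; rewrite /dz.
have h v : rdir v (fun w => \sum_(i <- r) c i * F i w) z =
    \sum_(i <- r) c i * rdir v (F i) z.
  by apply/rdirE/is_rdir_sum => i; apply: is_rdirM; apply: classC_is_rdir (cF i) Dz.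
rewrite !h mulr_sumr -sumrB mulr_suml; apply: eq_bigr => i _.
by rewrite [RHS]mulrA mulrBr [c i * ('i * _)]mulrCA.
Qed.

Lemma dzbar_lincomb k (I : Type) (r : seq I) (c : I -> Cx R) (F : I -> V -> Cx R) z :
  D z -> (forall i, classC 1 D (F i)) ->
  dzbar k (fun w => \sum_(i <- r) c i * F i w) z = \sum_(i <- r) c i * dzbar k (F i) z.
Proof.
move=> Dz cF; rewrite /dzbar.
have h v : rdir v (fun w => \sum_(i <- r) c i * F i w) z =
    \sum_(i <- r) c i * rdir v (F i) z.
  by apply/rdirE/is_rdir_sum => i; apply: is_rdirM; apply: classC_is_rdir (cF i) Dz.
rewrite !h mulr_sumr -big_split mulr_suml; apply: eq_bigr => i _ /=.
by rewrite [RHS]mulrA mulrDr [c i * ('i * _)]mulrCA.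
Qed.

Lemma dz_ext k F G z : D z -> classC 1 D F -> (forall w, D w -> F w = G w) ->
  dz k F z = dz k G z.
Proof.
move=> Dz cF FG; rewrite /dz; congr ((_ - _ * _) / 2);
  by apply/esym/rdirE/(is_rdir_ext oD Dz FG); apply: classC_is_rdir cF Dz.
Qed.

Lemma classC_dzbar n k F : classC n.+1 D F -> classC n D (dzbar k F).
Proof.
move=> cF; have h1 := classC_rdir (evec R k) cF.
have h2 := classC_rdir ('i *: evec R k) cF.
apply: (classC_ext oD _ (classCM 2^-1 oD (classCD oD h1 (classCM 'i oD h2)))).
by move=> w _; rewrite /dzbar mulrC.
Qed.

Lemma sesqEp (A : 'M[Cx R]_m) v w :
  sesq A v w = \sum_(p : 'I_m * 'I_m) v 0 p.1 * (w 0 p.2)^* * A p.1 p.2.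
Proof. by rewrite sesqE pair_bigA. Qed.

Context (e : V).
Local Notation energy := (fun z => sesq (g z) e e).

(** As a function of the point, the energy is a fixed linear combination of the
entries of the metric, so the Wirtinger derivatives of the metric tested on [e] are those
of the energy. *)
Lemma energy_lincomb : energy =
  (fun z => \sum_(p : 'I_m * 'I_m) e 0 p.1 * (e 0 p.2)^* * g z p.1 p.2).
Proof. by apply/funext => z; rewrite sesqEp. Qed.

Lemma classC_energy : classC 2 D energy.
Proof.
by rewrite energy_lincomb; apply: (classC_sum _ oD) => p; apply: (classCM _ oD); exact: sg.
Qed.

Lemma sesq_dzmx k z : D z -> sesq (dzmx k g z) e e = dz k energy z.
Proof.
move=> Dz; rewrite energy_lincomb (dz_lincomb _ _ _ Dz); last by move=> p; apply/classCW/sg.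
by rewrite sesqEp; apply: eq_bigr => p _; rewrite !mxE.
Qed.

Lemma sesq_dzmx_dzbarmx k l z : D z ->
  sesq (dzmx k (dzbarmx l g) z) e e = dz k (dzbar l energy) z.
Proof.
move=> Dz.
transitivity (dz k (fun w => \sum_(p : 'I_m * 'I_m)
    e 0 p.1 * (e 0 p.2)^* * dzbar l (fun w => g w p.1 p.2) w) z).
  rewrite (dz_lincomb _ _ _ Dz); last by move=> p; apply/classC_dzbar/sg.
  rewrite sesqEp; apply: eq_bigr => p _; rewrite !mxE.
  by congr (_ * dz k _ z); apply/funext => w; rewrite mxE.
apply: (dz_ext _ Dz).
  by apply: (classC_sum _ oD) => p; apply: (classCM _ oD); apply/classC_dzbar/sg.
move=> w Dw; rewrite energy_lincomb (dzbar_lincomb _ _ _ Dw).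
  by [].
by move=> p; exact/classCW/sg.
Qed.

Lemma dzbarmx_herm k z : D z -> dzbarmx k g z = (dzmx k g z) ^t*.
Proof.
move=> Dz; apply/matrixP => i j; rewrite !mxE.
have h v : rdir v (fun w => g w i j) z = (rdir v (fun w => g w j i) z)^*.
  apply: rdirE; apply: (is_rdir_ext oD Dz _ (is_rdir_conj (classC_is_rdir v (sg j i) Dz))).
  by move=> w Dw; rewrite -[in RHS](pg Dw).1 !mxE.
rewrite /dzbar /dz !h rmorphM rmorphB rmorphM /= conjCi fmorphV /= rmorph_nat.
by rewrite mulNr opprK.
Qed.

Lemma Im_energy z : D z -> complex.Im (energy z) = 0.
Proof. by move=> Dz /=; rewrite (sesq_real e (pg Dz).1). Qed.

Local Notation E1 := (rdir e energy).
Local Notation E2 := (rdir ('i *: e) energy).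

Lemma cabs_sqr_wirtinger (a b : Cx R) : complex.Im a = 0 -> complex.Im b = 0 ->
  cabs ((a - 'i * b) / 2) ^+ 2 = (complex.Re a ^+ 2 + complex.Re b ^+ 2) / 4.
Proof.
move=> a0 b0; rewrite mulrC [in LHS](_ : 2^-1 = ((2^-1 : R)%:C)%C); last first.
  by rewrite fmorphV rmorph_nat.
rewrite cabs_sqr !cReIm a0 b0 cRe_real cIm_real; lra.
Qed.

Lemma Re_quarter_laplacian (a b c d : Cx R) : complex.Im a = 0 ->
  complex.Im b = 0 -> complex.Im c = 0 -> complex.Im d = 0 ->
  complex.Re ((2^-1 * (a + 'i * b) - 'i * (2^-1 * (c + 'i * d))) / 2) =
  (complex.Re a + complex.Re d) / 4.
Proof.
have -> : (2^-1 : Cx R) = ((2^-1 : R)%:C)%C by rewrite fmorphV rmorph_nat.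
move=> a0 b0 c0 d0; rewrite !cReIm a0 b0 c0 d0 cRe_real cIm_real.
move: (complex.Re a) (complex.Re b) (complex.Re c) (complex.Re d) => x y u v.
lra.
Qed.

(** [d_e dbar_e] is a quarter of the Laplacian of the complex line directed by [e],
plus [i / 4] times the commutator of [D_e] and [D_(i e)]. The commutator of a real
function is real, so taking the real part removes it. *)
Lemma Re_dz_dzbar_energy z : D z ->
  complex.Re (\sum_(k < m) \sum_(l < m)
     e 0 k * (e 0 l)^* * dz k (dzbar l energy) z) =
  (complex.Re (rdir e E1 z) + complex.Re (rdir ('i *: e) E2 z)) / 4.
Proof.
move=> Dz.
have cE := classC_energy; have cE1 := classC_rdir e cE.
have cE2 := classC_rdir ('i *: e) cE.
pose H w : Cx R := 2^-1 * (E1 w + 'i * E2 w).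
have cH : classC 1 D H := classCM _ oD (classCD oD cE1 (classCM 'i oD cE2)).
have -> : \sum_(k < m) \sum_(l < m) e 0 k * (e 0 l)^* * dz k (dzbar l energy) z =
   \sum_(k < m) e 0 k * dz k H z.
  apply: eq_bigr => k _.
  have -> : dz k H z = dz k (fun w => \sum_l (e 0 l)^* * dzbar l energy w) z.
    apply: (dz_ext _ Dz cH) => w Dw.
    by rewrite (sum_dzbar oD Dw (classCW cE)) /H mulrC.
  rewrite (dz_lincomb _ _ _ Dz); last by move=> l; exact/classC_dzbar/cE.
  by rewrite mulr_sumr; apply: eq_bigr => l _; rewrite mulrA.
rewrite (sum_dz oD Dz cH).
have rH v : rdir v H z = 2^-1 * (rdir v E1 z + 'i * rdir v E2 z).
  apply: rdirE; apply: is_rdirM; apply: is_rdirD.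
    exact: classC_is_rdir cE1 Dz.
  by apply: is_rdirM; apply: classC_is_rdir cE2 Dz.
have iE1 w : D w -> complex.Im (E1 w) = 0.
  by move=> Dw; apply: (Im_rdir oD Dw (classCW cE)) => w' /Im_energy.
have iE2 w : D w -> complex.Im (E2 w) = 0.
  by move=> Dw; apply: (Im_rdir oD Dw (classCW cE)) => w' /Im_energy.
have i1 v := Im_rdir oD Dz cE1 v iE1; have i2 v := Im_rdir oD Dz cE2 v iE2.
rewrite (rH e) (rH ('i *: e)).
exact: (Re_quarter_laplacian (i1 e) (i2 e) (i1 _) (i2 _)).
Qed.

(** The way Cauchy-Schwarz enters the curvature inequality: [u] stands for the energy
of [e], [N] for that of [w], [X] for the squared modulus of their product and [L / 4] for
[d_e dbar_e u]. *)
Lemma cauchy_schwarz_curv (K u N X L : R) : 0 < u -> X <= N * u ->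
  - (L / 4) + N <= - K * u ^+ 2 -> X + K * u ^+ 3 <= u * L / 4.
Proof.
move=> u0 h1 h2; apply: le_trans (_ : N * u + K * u ^+ 3 <= _); first by rewrite lerD2r.
by have := ler_wpM2l (ltW u0) h2; rewrite exprSr; lra.
Qed.

(** With [A = sum_k e_k d_k g] and [w = e A g^-1], the holomorphic curvature in the
direction [e] is [- d_e dbar_e u + |w|^2], where [u] is the energy, while [d_e u] is the
product [<w, e>], so that [|d_e u|^2 <= |w|^2 u]. Eliminating [|w|^2] leaves the classical
[Delta log u >= 4 K u], multiplied by [u^2 / 4]. *)
Lemma curvature_energy (K : R) z : D z -> e != 0 -> hol_sect_curv g z e <= - K ->
  (complex.Re (E1 z) ^+ 2 + complex.Re (E2 z) ^+ 2) / 4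
    + K * complex.Re (energy z) ^+ 3
  <= complex.Re (energy z) *
     (complex.Re (rdir e E1 z) + complex.Re (rdir ('i *: e) E2 z)) / 4.
Proof.
move=> Dz e0; have pz := pg Dz; have [hz pos] := pz.
have u0 := pos e e0.
rewrite /hol_sect_curv ler_pdivrMr ?exprn_gt0 //.
pose A := \sum_k e 0 k *: dzmx k g z.
pose w := e *m A *m invmx (g z).
have gU := posdef_unit pz.
have we : sesq (g z) w e = (E1 z - 'i * E2 z) / 2.
  rewrite -(sum_dz oD Dz (classCW classC_energy)) /sesq /w mulmxKV //.
  rewrite -[LHS]/(sesq A e e) sesqE.
  under [RHS]eq_bigr => k _ do rewrite -sesq_dzmx // sesqE mulr_sumr.
  rewrite [RHS]exchange_big /=; apply: eq_bigr => i _.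
  under [RHS]eq_bigr => k _ do rewrite mulr_sumr.
  rewrite [RHS]exchange_big /=; apply: eq_bigr => j _.
  rewrite /A summxE mulr_sumr; apply: eq_bigr => k _; rewrite mxE; ring.
(* the Chern curvature tested on [e] *)
have curvE : \sum_(k < m) \sum_(l < m) e 0 k * (e 0 l)^* *
      sesq (chern_curv g k l z) e e =
    - \sum_(k < m) \sum_(l < m) e 0 k * (e 0 l)^* * dz k (dzbar l energy) z
    + sesq (g z) w w.
  have -> : sesq (g z) w w = \sum_(k < m) \sum_(l < m) e 0 k * (e 0 l)^* *
     sesq (dzmx k g z *m invmx (g z) *m dzbarmx l g z) e e.
    have AT : A ^t* = \sum_l (e 0 l)^* *: dzbarmx l g z.
      apply/matrixP => i j; rewrite /A !mxE !summxE rmorph_sum.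
      apply: eq_bigr => l _; rewrite dzbarmx_herm // !mxE.
      exact: rmorphM.
    have hi : (invmx (g z)) ^t* = invmx (g z) by rewrite trmx_inv map_invmx hz.
    rewrite /sesq {1}/w mulmxKV // {1}/w !trmx_mul !map_mxM hi AT /A.
    rewrite mulmx_sumr !mulmx_suml summxE; apply: eq_bigr => k _.
    rewrite !mulmx_sumr summxE; apply: eq_bigr => l _.
    rewrite -scalemxAl -!scalemxAr -!scalemxAl !mulmxA scalerA.
    by rewrite mxE; congr (_ * _); exact: mulrC.
  rewrite -sumrN -big_split /=; apply: eq_bigr => k _.
  rewrite -sumrN -big_split /=; apply: eq_bigr => l _.
  rewrite /chern_curv -sesq_dzmx_dzbarmx // /sesq mulmxDr mulmxDl mxE mulrDr.
  by rewrite mulmxN mulNmx mxE mulrN.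
rewrite curvE cReD cReN Re_dz_dzbar_energy //.
have iE v : complex.Im (rdir v energy z) = 0.
  by apply: (Im_rdir oD Dz (classCW classC_energy)) => w' /Im_energy.
have := posdef_cauchy_schwarz w e pz; rewrite we (cabs_sqr_wirtinger (iE _) (iE _)).
exact: cauchy_schwarz_curv.
Qed.

End CurvatureInequality.

(** * Second derivative test *)

Section SecondDerivativeTest.
Context (R : realType).
Implicit Types (f u : R -> R).

(** If the second derivative were positive at the maximum, the first one would be
positive just to its right. *)
Lemma second_derivative_test f f1 (f2 r : R) : 0 < r ->
  (forall t : R, `|t| < r -> is_derive t 1 f (f1 t)) ->
  (forall t : R, `|t| < r -> f t <= f 0) ->
  is_derive (0:R) (1:R) f1 f2 -> f1 0 = 0 /\ f2 <= 0.
Proof.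
move=> r0 df fmax df1.
have in_r t : t \in `](- r), r[ -> `|t| < r by rewrite in_itv /= -ltr_norml.
have f10 : f1 0 = 0.
  have h : is_derive (0:R) 1 f 0.
    apply: (derive1_at_max (a := - r) (b := r)).
    - lra.
    - by move=> t /in_r /df [].
    - by rewrite in_itv /= oppr_lt0 r0.
    - by move=> t /in_r /fmax.
  have h0 := df 0 (eq_ind_r (fun x => is_true (x < r)) r0 (normr0 _)).
  by have [_ <-] := h0; have [_ ->] := h.
split=> //; rewrite leNgt; apply/negP => f20.
have f2h : 0 < f2 / 2 by rewrite divr_gt0.
have [r' r'0 h] := (is_derive_eps f1 0 f2).1 df1 _ f2h.
pose t := Num.min r r' / 2.
have t0 : 0 < t by rewrite divr_gt0 // lt_min r0.
have [tr tr'] : t < r /\ t < r'.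
  have : Num.min r r' <= r by rewrite ge_min lexx.
  have : Num.min r r' <= r' by rewrite ge_min lexx orbT.
  rewrite /t; lra.
have small s : 0 <= s -> s <= t -> `|s| < r.
  by move=> s0 st; rewrite ger0_norm //; apply: le_lt_trans tr.
have [s||c] := @MVT R f f1 0 t t0.
- by rewrite in_itv /= => /andP[s0 st]; apply/df/small; apply: ltW.
- apply: derivable_within_continuous => s; rewrite in_itv /= => /andP[s0 st].
  by case: (df s (small s s0 st)).
rewrite in_itv /= subr0 => /andP[c0 ct] E.
have := fmax t (small t (ltW t0) (lexx t)).
have /h : `|c| < r' by rewrite gtr0_norm //; exact: lt_trans tr'.
rewrite add0r f10 subr0 (gtr0_norm c0) ler_norml => /andP[h1 _].
have : 0 < f1 c * t by rewrite mulr_gt0 //; have := mulr_gt0 f2h c0; lra.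
rewrite -E; lra.
Qed.

(** The second derivative test for [u y^2], where [y = d - 2 b t - t^2] is what
[rho^2 - |zeta|^2] becomes on a real line of unit speed through the maximum point. The
first order condition is used to eliminate the first derivative of [u] from the second. *)
Lemma weighted_max u u1 (u2 d b r : R) : 0 < r -> 0 < d ->
  (forall t : R, `|t| < r -> is_derive t 1 u (u1 t)) ->
  (forall t : R, `|t| < r -> u t * (d - 2 * b * t - t ^+ 2) ^+ 2 <= u 0 * d ^+ 2) ->
  is_derive (0:R) 1 u1 u2 ->
  u1 0 * d = 4 * b * u 0 /\ u2 * d ^+ 2 <= u 0 * (24 * b ^+ 2 + 4 * d).
Proof.
move=> r0 d0 du umax du1; have scaleE (x z : R) : x *: z = x * z by [].
pose y (t : R) := d - 2 * b * t - t ^+ 2; pose y1 (t : R) := - 2 * b - 2 * t.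
have dy (t : R) : is_derive t 1 y (y1 t).
  have h1 : is_derive t 1 (cst d) 0 by exact: is_derive_cst.
  have h2 := is_deriveZ (2 * b) (is_derive_id t (1:R)).
  have h3 := is_deriveX 2 (is_derive_id t (1:R)).
  have h := is_deriveB (is_deriveB h1 h2) h3.
  apply: is_derive_eq h _; rewrite /y1 /GRing.scale /=; ring.
have dy1 (t : R) : is_derive t 1 y1 (- 2).
  have h1 : is_derive t 1 (cst (- 2 * b)) 0 by exact: is_derive_cst.
  have h2 := is_deriveZ (2 : R) (is_derive_id t (1:R)).
  apply: is_derive_eq (is_deriveB h1 h2) _; rewrite /GRing.scale /=; ring.
pose f t := u t * (y t * y t).
pose f1 t := u1 t * (y t * y t) + u t * (2 * (y t * y1 t)).
have df (t : R) : `|t| < r -> is_derive t 1 f (f1 t).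
  move=> /du dut; apply: is_derive_eq (is_deriveM dut (is_deriveM (dy t) (dy t))) _.
  rewrite !scaleE /f1 -[(y * y) t]/(y t * y t); ring.
have y0 : y 0 = d by rewrite /y; ring.
have y10 : y1 0 = - 2 * b by rewrite /y1; ring.
have du0 : is_derive (0:R) 1 u (u1 0) by apply: du; rewrite normr0.
have df1 : is_derive (0:R) 1 f1
    (u2 * d ^+ 2 - 8 * b * d * u1 0 + u 0 * (8 * b ^+ 2 - 4 * d)).
  have h := is_deriveZ (2:R) (is_deriveM (dy 0) (dy1 0)).
  apply: is_derive_eq (is_deriveD (is_deriveM du1 (is_deriveM (dy 0) (dy 0)))
     (is_deriveM du0 h)) _.
  rewrite !scaleE -[(y * y) 0]/(y 0 * y 0) -[(2 \*: (y * y1)) 0]/(2 * (y 0 * y1 0)) y0 y10; ring.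
have [] := second_derivative_test r0 df _ df1.
  move=> t /umax; rewrite /f y0 -expr2; exact.
rewrite /f1 y0 y10 => e1 e2.
have key : u1 0 * d = 4 * b * u 0.
  by apply: (mulIf (lt0r_neq0 d0)); move: e1; lra.
split=> //; move: e2.
have -> : 8 * b * d * u1 0 = 8 * b * (u1 0 * d) by ring.
rewrite key; lra.
Qed.

End SecondDerivativeTest.

(** * The Schwarz lemma on flat discs *)

Section SchwarzLemma.
Context (R : realType).

Lemma compact_disc (rho : R) :
  compact [set ab : R * R | ab.1 ^+ 2 + ab.2 ^+ 2 <= rho ^+ 2].
Proof.
have cX := compact_setX (@segment_compact R (- `|rho|) `|rho|)
  (@segment_compact R (- `|rho|) `|rho|).
apply: subclosed_compact cX _.
- rewrite [X in closed X](_ : _ =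
    (fun ab : R * R => ab.1 ^+ 2 + ab.2 ^+ 2) @^-1` [set y | y <= rho ^+ 2]) //.
  apply: preimage_closed; last exact: closed_le.
  move=> ab _.
  have c1 : ab'.1 @[ab' --> ab] --> ab.1 by exact: cvg_fst.
  have c2 : ab'.2 @[ab' --> ab] --> ab.2 by exact: cvg_snd.
  exact: cvgD (cvgM c1 c1) (cvgM c2 c2).
- move=> [a b] /= h; split; rewrite /= in_itv /= -ler_norml;
    rewrite -(ler_pXn2r (n := 2)) ?nnegrE // !real_normK ?num_real //.
  + by have := sqr_ge0 b; lra.
  + by have := sqr_ge0 a; lra.
Qed.

Lemma disc_interior (rho a b : R) : 0 < rho -> a ^+ 2 + b ^+ 2 < rho ^+ 2 ->
  exists2 r : R, 0 < r & forall t : R, `|t| < r ->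
    (a + t) ^+ 2 + b ^+ 2 <= rho ^+ 2 /\ a ^+ 2 + (b + t) ^+ 2 <= rho ^+ 2.
Proof.
move=> rho0; rewrite -subr_gt0; set d := _ - _ => d0.
exists (Num.min 1 (d / (2 * rho + 1))); first by rewrite lt_min ltr01 divr_gt0 //; lra.
have small (c t : R) : c ^+ 2 <= rho ^+ 2 ->
    `|t| < Num.min 1 (d / (2 * rho + 1)) -> 2 * c * t + t ^+ 2 <= d.
  move=> c2; rewrite lt_min => /andP[t1]; rewrite ltr_pdivlMr => [td|]; last by lra.
  have c1 : `|c| <= rho.
    by rewrite -(ler_pXn2r (n := 2)) ?nnegrE ?real_normK ?num_real // ltW.
  apply: le_trans (ler_norm _) _; apply: le_trans (ler_normD _ _) _.
  apply: le_trans (ltW td); rewrite !normrM ger0_norm //.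
  have := ler_wpM2l (normr_ge0 t) c1; have := ler_wpM2l (normr_ge0 t) (ltW t1); lra.
have a2 : a ^+ 2 <= rho ^+ 2 by have := sqr_ge0 b; move: d0; rewrite /d; lra.
have b2 : b ^+ 2 <= rho ^+ 2 by have := sqr_ge0 a; move: d0; rewrite /d; lra.
by move=> t tr; have := small a t a2 tr; have := small b t b2 tr; rewrite /d; split; lra.
Qed.

(** The final step of the maximum principle: [u] is the energy at the maximum point
[zeta = a + i b] and [d = rho^2 - |zeta|^2]; [p, q] and [L1, L2] are the derivatives of
first and second order of [u] along the two axes. *)
Lemma max_principle_algebra (K u a b d p q L1 L2 rho : R) :
  0 < u -> 0 < d -> rho ^+ 2 = d + a ^+ 2 + b ^+ 2 ->
  p * d = 4 * a * u -> q * d = 4 * b * u ->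
  L1 * d ^+ 2 <= u * (24 * a ^+ 2 + 4 * d) ->
  L2 * d ^+ 2 <= u * (24 * b ^+ 2 + 4 * d) ->
  (p ^+ 2 + q ^+ 2) / 4 + K * u ^+ 3 <= u * (L1 + L2) / 4 ->
  K * (u * d ^+ 2) <= 2 * rho ^+ 2.
Proof.
move=> u0 d0 -> hp hq h1 h2 h.
have d20 : 0 < d ^+ 2 by rewrite exprn_gt0.
have u20 : 0 < u ^+ 2 by rewrite exprn_gt0.
rewrite -(ler_pM2l u20).
have := ler_wpM2l (ltW d20) h.
have -> : d ^+ 2 * ((p ^+ 2 + q ^+ 2) / 4 + K * u ^+ 3) =
  ((p * d) ^+ 2 + (q * d) ^+ 2) / 4 + u ^+ 2 * (K * (u * d ^+ 2)) by ring.
have -> : d ^+ 2 * (u * (L1 + L2) / 4) = u * (L1 * d ^+ 2 + L2 * d ^+ 2) / 4 by ring.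
rewrite hp hq.
have : u * (L1 * d ^+ 2 + L2 * d ^+ 2) <=
       u * (u * (24 * a ^+ 2 + 4 * d) + u * (24 * b ^+ 2 + 4 * d)).
  by rewrite (ler_pM2l u0); exact: lerD.
have -> : ((4 * a * u) ^+ 2 + (4 * b * u) ^+ 2) / 4 = 4 * (u ^+ 2 * a ^+ 2 + u ^+ 2 * b ^+ 2).
  by field.
have -> : u * (u * (24 * a ^+ 2 + 4 * d) + u * (24 * b ^+ 2 + 4 * d)) =
  u ^+ 2 * (24 * (a ^+ 2 + b ^+ 2) + 8 * d) by ring.
move: (u ^+ 2 * (K * _)) (u * (_ + _)) => X Y; lra.
Qed.

Context (m : nat).
Local Notation V := 'rV[Cx R]_m.
Context (D : set V) (g : V -> 'M[Cx R]_m) (K : R).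
Context (oD : open D) (pg : forall z, D z -> posdef (g z))
  (sg : forall i j, classC 2 D (fun z => g z i j)) (K0 : 0 < K)
  (curvK : forall z v, D z -> v != 0 -> hol_sect_curv g z v <= - K).

Lemma continuous_plane (E : V -> Cx R) (x e : V) (ab : R * R) :
  {for x + (Complex ab.1 ab.2 : Cx R) *: e, continuous E} ->
  complex.Re (E (x + (Complex ab'.1 ab'.2 : Cx R) *: e)) @[ab' --> ab] -->
  complex.Re (E (x + (Complex ab.1 ab.2 : Cx R) *: e)).
Proof.
move=> /for_continuous_rnorm cE.
have c1 : ab'.1 @[ab' --> ab] --> ab.1 by exact: cvg_fst.
have c2 : ab'.2 @[ab' --> ab] --> ab.2 by exact: cvg_snd.
apply/cvgrPdist_lt => eps /cE[r r0 hr].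
have n0 : 0 < rnorm e + 1 by have := rnorm_ge0 e; lra.
pose s := r / (rnorm e + 1) / 2.
have s0 : 0 < s by rewrite /s !divr_gt0.
near=> ab'.
have n1 : `|ab.1 - ab'.1| < s by near: ab'; exact: (cvgrPdist_lt _ _).1 c1 s s0.
have n2 : `|ab.2 - ab'.2| < s by near: ab'; exact: (cvgrPdist_lt _ _).1 c2 s s0.
rewrite distrC -cReN -cReD; apply: le_lt_trans (cRe_le _) _; apply: hr.
rewrite [X in rnorm X](_ : _ =
  (Complex (ab'.1 - ab.1) (ab'.2 - ab.2) : Cx R) *: e); last first.
  by rewrite opprD addrACA subrr add0r -scalerBl.
rewrite rnormZ; apply: le_lt_trans (_ : (s + s) * rnorm e < _).
  rewrite ler_wpM2r ?rnorm_ge0 //; apply: le_trans (cabs_le _) _ => /=.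
  by rewrite lerD // ltW // distrC.
have -> : s + s = r / (rnorm e + 1) by rewrite -splitr.
by rewrite mulrAC ltr_pdivrMr // ltr_pM2l // ltrDl.
Unshelve. all: by end_near.
Qed.

(** The lemma of Ahlfors. The function [u(zeta) (rho^2 - |zeta|^2)^2] vanishes on the
boundary circle, so it has an interior maximum; there the second derivative test along
[1] and [i] bounds the Laplacian of [log u] from above and the curvature bounds it from
below, and the comparison of both bounds the maximum by [2 rho^2 / K]. The value at
[zeta = 0] gives the claim. *)
Theorem schwarz_disc (x e : V) (rho : R) : 0 < rho -> e != 0 ->
  (forall zeta : Cx R, cabs zeta <= rho -> D (x + zeta *: e)) ->
  complex.Re (sesq (g x) e e) * rho ^+ 2 <= 2 / K.
Proof.
move=> rho0 e0 discD.
pose pt (a b : R) : V := x + (Complex a b : Cx R) *: e.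
pose E (z : V) : Cx R := sesq (g z) e e.
have cE : classC 2 D E := classC_energy oD sg e.
pose F (ab : R * R) : R := complex.Re (E (pt ab.1 ab.2)) *
  (rho ^+ 2 - (ab.1 ^+ 2 + ab.2 ^+ 2)) ^+ 2.
pose S := [set ab : R * R | ab.1 ^+ 2 + ab.2 ^+ 2 <= rho ^+ 2].
have SD a b : a ^+ 2 + b ^+ 2 <= rho ^+ 2 -> D (pt a b).
  move=> h; apply: discD; rewrite cabsE /= -(ger0_norm (ltW rho0)) -sqrtr_sqr.
  exact: ler_wsqrtr.
have S00 : S (0, 0) by rewrite /S /= expr0n addr0 sqr_ge0.
have ptD1 a b t : pt (a + t) b = pt a b + t **: e.
  rewrite /pt -addrA -scalerDl; congr (_ + _ *: _).
  by apply: cx_eqP; rewrite !cReIm //= addr0.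
have ptD2 a b t : pt a (b + t) = pt a b + t **: ('i *: e).
  rewrite /pt -addrA scalerA -scalerDl; congr (_ + _ *: _).
  by apply: cx_eqP; rewrite !cReIm /=; ring.
have pt00 : pt 0 0 = x.
  have z : (Complex 0 0 : Cx R) = 0 by [].
  by rewrite /pt z scale0r addr0.
have contF : {within S, continuous F}.
  apply: continuous_in_subspaceT => ab /set_mem Sab.
  have c1 : ab'.1 @[ab' --> ab] --> ab.1 by exact: cvg_fst.
  have c2 : ab'.2 @[ab' --> ab] --> ab.2 by exact: cvg_snd.
  have cw : rho ^+ 2 - (ab'.1 * ab'.1 + ab'.2 * ab'.2) @[ab' --> ab] -->
      rho ^+ 2 - (ab.1 * ab.1 + ab.2 * ab.2).
    exact: cvgB (cvg_cst _) (cvgD (cvgM c1 c1) (cvgM c2 c2)).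
  have cEpt := continuous_plane (classC_continuous cE (SD _ _ Sab)).
  exact: cvgM cEpt (cvgM cw cw).
have [|[a b] /set_mem Sab maxF] := compact_EVT_max _ (@compact_disc rho) contF.
  by exists (0, 0).
have {}maxF a' b' : a' ^+ 2 + b' ^+ 2 <= rho ^+ 2 -> F (a', b') <= F (a, b).
  by move=> h; apply: maxF; apply/mem_set.
have z0D : D (pt a b) by exact: SD.
pose d := rho ^+ 2 - (a ^+ 2 + b ^+ 2).
pose u := complex.Re (E (pt a b)).
have u0 : 0 < u by apply: (pg z0D).2.
have F00 : F (0, 0) = complex.Re (E x) * rho ^+ 4.
  by rewrite /F [pt _ _]pt00 /= expr0n addr0 subr0 -exprM.
have FE a' b' : F (a', b') = complex.Re (E (pt a' b')) *
    (rho ^+ 2 - (a' ^+ 2 + b' ^+ 2)) ^+ 2 by [].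
have Fab : F (a, b) = u * d ^+ 2 by [].
have Dx : D x by rewrite -pt00; exact: SD.
have d0 : 0 < d.
  rewrite lt_def subr_ge0 Sab andbT; apply/eqP => dE.
  have F0 : F (a, b) = 0 by rewrite Fab dE expr2 !mulr0.
  have Ex0 := mulr_gt0 ((pg Dx).2 e e0) (exprn_gt0 4 rho0).
  have := maxF 0 0 S00; rewrite F0 F00 => h; by have := lt_le_trans Ex0 h; rewrite ltxx.
have [r r0 inS] : exists2 r : R, 0 < r & forall t : R, `|t| < r ->
    (a + t) ^+ 2 + b ^+ 2 <= rho ^+ 2 /\ a ^+ 2 + (b + t) ^+ 2 <= rho ^+ 2.
  by apply: disc_interior => //; rewrite -subr_gt0.
have cE1 := classC_rdir e cE; have cE2 := classC_rdir ('i *: e) cE.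
have [p1 L1] : complex.Re (rdir e E (pt a b)) * d = 4 * a * u /\
   complex.Re (rdir e (rdir e E) (pt a b)) * d ^+ 2 <= u * (24 * a ^+ 2 + 4 * d).
  have := @weighted_max R (fun t => complex.Re (E (pt a b + t **: e)))
    (fun t => complex.Re (rdir e E (pt a b + t **: e))) _ d a r r0 d0.
  rewrite !scale0r !addr0; apply.
  - move=> t tr; apply: is_rdir_derive_Re; apply: classC_is_rdir (classCW cE) _.
    by rewrite -ptD1; apply/SD/(inS t tr).1.
  - move=> t tr; have := maxF _ _ (inS t tr).1; rewrite FE Fab ptD1.
    congr (_ * _ ^+ 2 <= _); rewrite /d; ring.
  - apply: is_rdir_derive_Re; rewrite scale0r addr0.
    exact: classC_is_rdir cE1 z0D.
have [p2 L2] : complex.Re (rdir ('i *: e) E (pt a b)) * d = 4 * b * u /\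
   complex.Re (rdir ('i *: e) (rdir ('i *: e) E) (pt a b)) * d ^+ 2
     <= u * (24 * b ^+ 2 + 4 * d).
  have := @weighted_max R (fun t => complex.Re (E (pt a b + t **: ('i *: e))))
    (fun t => complex.Re (rdir ('i *: e) E (pt a b + t **: ('i *: e)))) _ d b r r0 d0.
  rewrite !scale0r !addr0; apply.
  - move=> t tr; apply: is_rdir_derive_Re; apply: classC_is_rdir (classCW cE) _.
    by rewrite -ptD2; apply/SD/(inS t tr).2.
  - move=> t tr; have := maxF _ _ (inS t tr).2; rewrite FE Fab ptD2.
    congr (_ * _ ^+ 2 <= _); rewrite /d; ring.
  - apply: is_rdir_derive_Re; rewrite scale0r addr0.
    exact: classC_is_rdir cE2 z0D.
have rhoE : rho ^+ 2 = d + a ^+ 2 + b ^+ 2 by rewrite /d; ring.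
have := max_principle_algebra u0 d0 rhoE p1 p2 L1 L2
  (curvature_energy oD pg sg z0D e0 (curvK z0D e0)).
have := maxF 0 0 S00; rewrite F00 Fab => h1 h2.
rewrite ler_pdivlMr // -(ler_pM2r (exprn_gt0 2 rho0)).
apply: le_trans h2; move: (ler_wpM2l (ltW K0) h1); congr (_ <= _).
by rewrite -/(E x); ring.
Qed.

End SchwarzLemma.

(** * Taylor bounds *)

Section Taylor.
Context (R : realType) (m : nat).
Local Notation V := 'rV[Cx R]_m.
Implicit Types (F : V -> Cx R) (v w x z h : V).
Context (U : set V) (oU : open U).

(** Coordinates in this real frame bound the derivatives in varying directions by those
in finitely many fixed ones, which are continuous. *)
Definition rframe (j : 'I_m * bool) : V :=
  if j.2 then 'i *: evec R j.1 else evec R j.1.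
Definition rcoord v (j : 'I_m * bool) : R :=
  if j.2 then complex.Im (v 0 j.1) else complex.Re (v 0 j.1).

Lemma rdir_rframe F z v : U z -> classC 1 U F ->
  rdir v F z = \sum_j ((rcoord v j)%:C)%C * rdir (rframe j) F z.
Proof.
move=> Uz cF; rewrite {1}(evec_sum v) (rdir_sumv oU Uz cF).
rewrite -(pair_bigA _ (fun k b => ((rcoord v (k, b))%:C)%C * rdir (rframe (k, b)) F z)) /=.
apply: eq_bigr => k _; rewrite big_bool.
by apply: etrans (rdir_cx oU Uz cF (v 0 k) (evec R k)) _; exact: addrC.
Qed.

Lemma rcoord_le v (M : R) j : (forall k, cabs (v 0 k) <= M) -> `|rcoord v j| <= M.
Proof.
move=> h; rewrite /rcoord; case: ifP => _; apply: le_trans (h j.1).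
  exact: cIm_le.
exact: cRe_le.
Qed.

Lemma rdir_bound F z v (M : R) : U z -> classC 1 U F ->
  (forall k, cabs (v 0 k) <= M) ->
  cabs (rdir v F z) <= M * \sum_j cabs (rdir (rframe j) F z).
Proof.
move=> Uz cF hM; rewrite (rdir_rframe v Uz cF); apply: le_trans (cabs_sum _ _ _) _.
rewrite mulr_sumr; apply: ler_sum => j _; rewrite cabsM cabs_real.
by rewrite ler_wpM2r ?cabs_ge0 // rcoord_le.
Qed.

Lemma rdir2_bound F z v (M : R) : U z -> classC 2 U F -> 0 <= M ->
  (forall k, cabs (v 0 k) <= M) ->
  cabs (rdir v (rdir v F) z) <=
  M ^+ 2 * \sum_i \sum_j cabs (rdir (rframe i) (rdir (rframe j) F) z).
Proof.
move=> Uz cF M0 hM; have cv := classC_rdir v cF.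
apply: le_trans (rdir_bound Uz cv hM) _.
rewrite expr2 -mulrA ler_wpM2l // mulr_sumr; apply: ler_sum => i _.
have -> : rdir (rframe i) (rdir v F) z =
    \sum_j ((rcoord v j)%:C)%C * rdir (rframe i) (rdir (rframe j) F) z.
  apply: rdirE; apply: (is_rdir_ext (F := fun w =>
    \sum_j (((rcoord v j)%:C)%C : Cx R) * rdir (rframe j) F w) oU Uz).
    by move=> w Uw; rewrite (rdir_rframe v Uw (classCW cF)).
  apply: is_rdir_sum => j; apply: is_rdirM.
  exact: classC_is_rdir (classC_rdir _ cF) Uz.
apply: le_trans (cabs_sum _ _ _) _; rewrite mulr_sumr; apply: ler_sum => j _.
by rewrite cabsM cabs_real ler_wpM2r ?cabs_ge0 // rcoord_le.
Qed.

Lemma taylor1 F x h (C : R) : classC 1 U F ->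
  (forall t : R, 0 <= t <= 1 -> U (x + t **: h) /\
     cabs (rdir h F (x + t **: h)) <= C) ->
  complex.Re (F (x + h)) <= complex.Re (F x) + C.
Proof.
move=> cF hC.
have [s s01 E] := @mvt_Re R m F x h (rdir h F)
  (fun s s01 => classC_is_rdir h cF (hC s s01).1).
rewrite -lerBlDl -cReN -cReD E; apply: le_trans (hC s s01).2.
exact: le_trans (ler_norm _) (cRe_le _).
Qed.

(** The increment is the derivative at an intermediate point, which in turn exceeds
the derivative at [x] by at most [C]. *)
Lemma taylor2 F x h (C : R) : classC 2 U F -> complex.Re (rdir h F x) <= 0 ->
  (forall t : R, 0 <= t <= 1 -> U (x + t **: h) /\
     cabs (rdir h (rdir h F) (x + t **: h)) <= C) ->
  complex.Re (F (x + h)) <= complex.Re (F x) + C.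
Proof.
move=> cF h0 hC.
have [s /andP[s0 s1] E] := @mvt_Re R m F x h (rdir h F)
  (fun s s01 => classC_is_rdir h (classCW cF) (hC s s01).1).
rewrite -lerBlDl -cReN -cReD E.
suff h' : complex.Re (rdir h F (x + s **: h)) <= complex.Re (rdir h F x) + C.
  by apply: le_trans h' _; rewrite gerDr.
apply: (taylor1 (classC_rdir h cF)) => t /andP[t0 t1].
have ts : 0 <= t * s <= 1 by rewrite mulr_ge0 //= mulr_ile1.
rewrite scalerA -(rmorphM (real_complex R)); have [Ut Ct] := hC _ ts.
split; first exact: Ut.
rewrite (rdir_scalev Ut (classC_rdir h cF) s h) cabsM cabs_real.
by apply: le_trans Ct; rewrite ger0_norm // ler_piMl // cabs_ge0.
Qed.

Lemma near_cabs_le (G : V -> Cx R) p : {for p, continuous G} ->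
  \forall z \near p, cabs (G z) <= cabs (G p) + 1.
Proof.
move=> /for_continuous_rnorm /(_ _ ltr01)[r r0 h]; apply/nbhs_rnorm; exists r => // w /h.
have := cabsD (G w - G p) (G p); rewrite subrK; lra.
Qed.

Lemma near_cabs_ge (G : V -> Cx R) p : {for p, continuous G} -> G p != 0 ->
  \forall z \near p, cabs (G p) / 2 <= cabs (G z).
Proof.
move=> /for_continuous_rnorm cG /cabs_gt0 g0.
have [|r r0 h] := cG (cabs (G p) / 2); first by rewrite divr_gt0.
apply/nbhs_rnorm; exists r => // w /h.
have := cabsD (G p - G w) (G w); rewrite subrK -(cabsN (G p - G w)) opprB; lra.
Qed.

Lemma near_Re_gt (G : V -> Cx R) p (c : R) : {for p, continuous G} ->
  c < complex.Re (G p) -> \forall z \near p, c < complex.Re (G z).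
Proof.
move=> /for_continuous_rnorm cG; rewrite -subr_gt0 => c0.
have [r r0 h] := cG _ c0; apply/nbhs_rnorm; exists r => // w /h.
move=> hw; have := le_lt_trans (cRe_le _) hw; rewrite cReD cReN ltr_norml; lra.
Qed.

(** For a real function the derivative is twice the real part of its complex linear
part; thus a vector killed by [sum_k v_k d/dz_k] is tangent together with all its complex
multiples. *)
Lemma Re_rdir_dz F z v : classC 1 U F -> U z ->
  (forall w, U w -> complex.Im (F w) = 0) ->
  complex.Re (rdir v F z) = 2 * complex.Re (\sum_k v 0 k * dz k F z).
Proof.
move=> cF Uz rF; rewrite (sum_dz oU Uz cF).
have := Im_rdir oU Uz cF v rF; have := Im_rdir oU Uz cF ('i *: v) rF.
move: (rdir v F z) (rdir _ F z) => A B iB iA.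
have -> : (2^-1 : Cx R) = ((2^-1 : R)%:C)%C by rewrite fmorphV rmorph_nat.
rewrite !cReIm iA iB cRe_real cIm_real.
move: (complex.Re A) (complex.Re B) => a b; lra.
Qed.

End Taylor.

(** * Distance to the boundary *)

Section Boundary.
Context (R : realType) (m : nat).
Local Notation V := 'rV[Cx R]_m.
Implicit Types (F : V -> Cx R) (v w x z h n : V).

Lemma eucl_norm_ge0 v : 0 <= eucl_norm v.
Proof. exact: sqrtr_ge0. Qed.

Lemma eucl_normZ (a : Cx R) v : eucl_norm (a *: v) = cabs a * eucl_norm v.
Proof.
rewrite /eucl_norm; under eq_bigr => k _ do rewrite mxE cabsM exprMn.
by rewrite -mulr_sumr sqrtrM ?sqr_ge0 // sqrtr_sqr ger0_norm // cabs_ge0.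
Qed.

Lemma dist_bdry_lb (D : set V) x : has_lbound [set eucl_norm (x - y) | y in bdry D].
Proof. by exists 0 => _ [y _ <-]; exact: eucl_norm_ge0. Qed.

Lemma rnorm_coord_le v (M : R) : 0 <= M -> (forall k, cabs (v 0 k) <= M) ->
  rnorm v <= M.
Proof.
move=> M0 hM; have [v0|v0] := eqVneq (mx_norm v) 0.
  by rewrite (mx_norm_eq0 v0) rnorm0.
have [[i k] /= E] := mx_norm_neq0 v0.
have -> : rnorm v = cabs (v 0 k) by rewrite /rnorm /Num.norm /= E (ord1 i).
exact: hM.
Qed.

Lemma rnorm_eucl v : rnorm v <= eucl_norm v.
Proof.
apply: rnorm_coord_le (eucl_norm_ge0 v) _ => k.
rewrite /eucl_norm -(ger0_norm (cabs_ge0 (v 0 k))) -sqrtr_sqr ler_wsqrtr //.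
by rewrite (bigD1 k) //= lerDl sumr_ge0 // => j _; rewrite sqr_ge0.
Qed.

Lemma dist_bdry_gt0 (D : set V) x : open D -> D x -> bdry D !=set0 ->
  0 < dist_bdry D x.
Proof.
move=> oD Dx [p bp]; have [r r0 h] := open_rnorm oD Dx.
apply: lt_le_trans r0 _; apply: lb_le_inf; first by exists (eucl_norm (x - p)); exists p.
move=> _ [y [_ ny] <-]; rewrite leNgt; apply/negP => yr; apply: ny.
rewrite (interior_id _).1 //; apply: h; rewrite -rnormN opprB.
exact: le_lt_trans (rnorm_eucl _) yr.
Qed.

Lemma first_zero (f f1 : R -> R) (c T : R) : 0 < c -> 0 <= T ->
  (forall t : R, 0 <= t <= T -> is_derive t 1 f (f1 t)) ->
  (forall t : R, 0 <= t <= T -> c <= f1 t) ->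
  f 0 < 0 -> - f 0 <= c * T ->
  exists2 t : R, 0 < t <= T & f t = 0 /\ forall s : R, 0 <= s -> s < t -> f s < 0.
Proof.
move=> c0 T0 df hf1 f0 hT.
have grow (s t : R) : 0 <= s -> s < t -> t <= T -> f s + c * (t - s) <= f t.
  move=> s0 st tT.
  have sub (y : R) : s <= y <= t -> 0 <= y <= T.
    by move=> /andP[sy yt]; rewrite (le_trans s0 sy) (le_trans yt tT).
  have [y|| y] := @MVT R f f1 s t st.
  - by rewrite in_itv /= => /andP[? ?]; apply/df/sub; rewrite !ltW.
  - apply: derivable_within_continuous => y; rewrite in_itv /= => /sub yT.
    by case: (df y yT).
  rewrite in_itv /= => /andP[sy yt] E.
  by rewrite -lerBrDl E ler_pM2r ?subr_gt0 //; apply/hf1/sub; rewrite !ltW.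
have T00 : 0 < T.
  rewrite lt_neqAle T0 andbT; apply/eqP => Tz.
  by move: hT; rewrite -Tz mulr0 oppr_le0 leNgt f0.
have fT : 0 <= f T by have := grow 0 T (lexx _) T00 (lexx _); rewrite subr0; lra.
have cf : {within `[0, T], continuous f}.
  apply: derivable_within_continuous => t; rewrite in_itv /= => tT.
  by case: (df t tT).
have [|t] := @IVT R f 0 T 0 T0 cf.
  by rewrite ge_min le_max (ltW f0) fT orbT.
rewrite in_itv /= => /andP[t0 tT] ft0; exists t.
  rewrite tT andbT lt_neqAle t0 andbT; apply/eqP => tz.
  by move: f0 ft0; rewrite -tz => + f00; rewrite f00 ltxx.
split=> // s s0 st; have := grow s t s0 st tT.
have := mulr_gt0 c0 (_ : 0 < t - s); rewrite subr_gt0 => /(_ st); rewrite ft0; lra.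
Qed.

(** [Re F] is negative at [x] and grows at rate at least [c] along [n], so the ray from
[x] has a first zero of [Re F] at a time at most [T]; that zero is not in [D], but it is a
limit of points of [D]. *)
Lemma dist_bdry_le (D U : set V) F x n (c T : R) : open D -> open U ->
  classC 1 U F -> (forall z, U z -> (D z <-> complex.Re (F z) < 0)) -> D x ->
  0 < c -> 0 <= T -> - complex.Re (F x) <= c * T ->
  (forall t : R, 0 <= t <= T ->
     U (x + t **: n) /\ c <= complex.Re (rdir n F (x + t **: n))) ->
  dist_bdry D x <= T * eucl_norm n.
Proof.
move=> oD oU cF DU Dx c0 T0 hT hU.
pose f (t : R) := complex.Re (F (x + t **: n)).
have df (t : R) : 0 <= t <= T -> is_derive t 1 f (complex.Re (rdir n F (x + t **: n))).
  by move=> t01; apply: is_rdir_derive_Re; apply: classC_is_rdir cF (hU t t01).1.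
have f0 : f 0 = complex.Re (F x) by rewrite /f scale0r addr0.
have Ux : U x by have := (hU 0); rewrite scale0r addr0 lexx T0 => /(_ isT)[].
have fx : f 0 < 0 by rewrite f0; apply/DU.
rewrite -f0 in hT.
have [t /andP[t0 tT] [ft0 fneg]] := first_zero c0 T0 df (fun t tT => (hU t tT).2) fx hT.
pose y := x + t **: n.
have Uy : U y by apply: (hU t _).1; rewrite (ltW t0).
have nDy : ~ D y by move/(DU y Uy); rewrite -/(f t) ft0 ltxx.
have by_ : bdry D y.
  split; last by rewrite (interior_id _).1.
  move=> B /nbhs_rnorm[r r0 hB].
  have n0 : 0 < rnorm n + 1 := ltr_wpDl (rnorm_ge0 n) ltr01.
  pose s := Num.min t (r / (rnorm n + 1)).
  have s0 : 0 < s by rewrite lt_min t0 divr_gt0.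
  have st : s <= t by rewrite ge_min lexx.
  have sr : s * (rnorm n + 1) <= r by rewrite -ler_pdivlMr // ge_min lexx orbT.
  have ts : 0 <= t - s by rewrite subr_ge0.
  have sT : t - s <= T by apply: le_trans tT; rewrite gerBl ltW.
  exists (x + (t - s) **: n); split.
    apply/DU; first by apply: (hU _ _).1; rewrite ts.
    by apply: fneg => //; rewrite gtrBl.
  apply: hB; rewrite /y opprD addrACA subrr add0r -scalerBl.
  rewrite -(rmorphB (real_complex R)) rnorm_scale addrAC subrr add0r normrN.
  by rewrite gtr0_norm //; apply: lt_le_trans sr; rewrite ltr_pM2l // ltrDl.
apply: le_trans (_ : eucl_norm (x - y) <= _).
  by apply: ge_inf; [exact: dist_bdry_lb | exists y].
rewrite /y opprD addNKr -scaleNr eucl_normZ cabsN cabs_real gtr0_norm //.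
by rewrite ler_wpM2r ?eucl_norm_ge0.
Qed.

End Boundary.

(** * Discs near a point of a C^2 boundary *)

Section BoundaryDiscs.
Context (R : realType) (m : nat).
Local Notation V := 'rV[Cx R]_m.
Implicit Types (F : V -> Cx R) (v w x z h n : V).

(** A nonzero derivative in some real direction yields a nonzero [d/dz_i0] and, after
a real rescaling of the direction, a positive derivative; all the bounds persist near [p]
by continuity. *)
Lemma boundary_local_bounds (U : set V) F p v : open U -> U p -> classC 2 U F ->
  (forall z, U z -> complex.Im (F z) = 0) -> rdir v F p != 0 ->
  exists (i0 : 'I_m) (n : V) (c L N B r : R),
    [/\ 0 < c, 0 <= L, 0 <= N, 0 <= B & 0 < r] /\
    forall z, rnorm (z - p) < r ->
      [/\ U z /\ c <= complex.Re (rdir n F z),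
          \sum_j cabs (rdir (rframe R j) F z) <= L,
          \sum_i \sum_j cabs (rdir (rframe R i) (rdir (rframe R j) F) z) <= N,
          dz i0 F z != 0 &
          forall k, cabs (dz k F z / dz i0 F z) <= B].
Proof.
move=> oU Up cF rF vp.
have cF1 := classCW cF.
have cont1 w : {for p, continuous (rdir w F)}.
  exact: classC_continuous (classC_rdir w cF) Up.
have cont2 w w' : {for p, continuous (rdir w (rdir w' F))}.
  exact: classC_continuous (classC_rdir w (classC_rdir w' cF)) Up.
have contz k : {for p, continuous (dz k F)}.
  have c1 := classC_rdir (evec R k) cF; have c2 := classC_rdir ('i *: evec R k) cF.
  have h := classCM 2^-1 oU (classCD oU c1 (classCM (- 'i) oU c2)).
  apply: (classC_continuous (n := 1) (U := U)) Up; apply: classC_ext h => // w _.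
  by rewrite /dz mulrC mulNr.
have [i0 zi0] : exists i0, dz i0 F p != 0.
  apply/existsP; apply: contraNT vp => /existsPn z0; apply/eqP/cx_eqP.
    rewrite (Re_rdir_dz oU v cF1 Up rF) big1 ?mulr0 // => k _.
    by have /negPn/eqP -> := z0 k; rewrite mulr0.
  exact: Im_rdir oU Up cF1 v rF.
(* [cv v] is a direction of growth whatever the sign of [cv] *)
pose cv := complex.Re (rdir v F p).
have cv0 : cv != 0.
  apply: contra vp => /eqP c0; apply/eqP/cx_eqP => //.
  exact: Im_rdir oU Up cF1 v rF.
have cn0 : 0 < complex.Re (rdir (cv **: v) F p).
  rewrite (rdir_scalev Up cF1 cv v) cReM cIm_real mul0r subr0 -expr2.
  by rewrite lt_def sqr_ge0 sqrf_eq0 cv0.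
pose c := complex.Re (rdir (cv **: v) F p) / 2.
have c0 : 0 < c by rewrite divr_gt0.
pose kap := cabs (dz i0 F p) / 2.
have kap0 : 0 < kap by rewrite divr_gt0 // cabs_gt0.
exists i0, (cv **: v), c, (\sum_j (cabs (rdir (rframe R j) F p) + 1)),
  (\sum_i \sum_j (cabs (rdir (rframe R i) (rdir (rframe R j) F) p) + 1)),
  (\sum_k (cabs (dz k F p) + 1) / kap).
have cabs1_ge0 (a : Cx R) : 0 <= cabs a + 1 by rewrite addr_ge0 // cabs_ge0.
have : \forall z \near p,
      [/\ U z /\ c <= complex.Re (rdir (cv **: v) F z),
          forall j, cabs (rdir (rframe R j) F z) <= cabs (rdir (rframe R j) F p) + 1,
          forall i j, cabs (rdir (rframe R i) (rdir (rframe R j) F) z)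
             <= cabs (rdir (rframe R i) (rdir (rframe R j) F) p) + 1,
          kap <= cabs (dz i0 F z) &
          forall k, cabs (dz k F z) <= cabs (dz k F p) + 1].
  near=> z; split.
  - split; near: z; first exact: open_nbhs_nbhs.
    have : \forall z \near p, c < complex.Re (rdir (cv **: v) F z).
      by apply: near_Re_gt => //; rewrite ltr_pdivrMr // mulr_natr mulr2n ltrDl.
    by apply: filterS => z /ltW.
  - by near: z; apply: filter_forall => j; apply: near_cabs_le.
  - near: z; apply: filter_forall => i; apply: filter_forall => j.
    exact: near_cabs_le.
  - by near: z; apply: near_cabs_ge.
  - by near: z; apply: filter_forall => k; apply: near_cabs_le.
move=> /nbhs_rnorm[r r0 hr]; exists r; split.
  split=> //; try by apply: sumr_ge0 => i _ //; apply: sumr_ge0.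
  by apply: sumr_ge0 => k _; rewrite divr_ge0 // ltW.
move=> z /hr[hU h1 h2 h3 h4]; split; first exact: hU.
- exact: ler_sum.
- by apply: ler_sum => i _; apply: ler_sum.
- by apply: contraTneq h3 => ->; rewrite cabs0 -ltNge.
- move=> k; rewrite cabsM cabsV.
  apply: le_trans (_ : (cabs (dz k F p) + 1) / kap <= _).
    apply: ler_pM; rewrite ?cabs_ge0 ?invr_ge0 ?cabs_ge0 //.
    by rewrite lef_pV2 ?posrE // (lt_le_trans kap0).
  by rewrite (bigD1 k) //= lerDl sumr_ge0 // => j _; rewrite divr_ge0 // ltW.
Unshelve. all: by end_near.
Qed.

Section Ball.
Context (U : set V) (F : V -> Cx R) (p : V) (L N r : R).
Context (oU : open U) (cF : classC 2 U F)
  (bU : forall z, rnorm (z - p) < r -> U z)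
  (bL : forall z, rnorm (z - p) < r -> \sum_j cabs (rdir (rframe R j) F z) <= L)
  (bN : forall z, rnorm (z - p) < r ->
     \sum_i \sum_j cabs (rdir (rframe R i) (rdir (rframe R j) F) z) <= N).
Context (x h : V) (M : R) (M0 : 0 <= M) (hM : forall k, cabs (h 0 k) <= M)
  (xr : rnorm (x - p) < r / 2) (Mr : M < r / 2).

Lemma segment_in_ball (t : R) : 0 <= t <= 1 -> rnorm (x + t **: h - p) < r.
Proof.
move=> /andP[t0 t1]; rewrite addrAC [r]splitr; apply: le_lt_trans (rnormD _ _) _.
apply: ltrD => //; apply: le_lt_trans Mr; rewrite rnorm_scale ger0_norm //.
by apply: le_trans (rnorm_coord_le M0 hM); rewrite ler_piMl // rnorm_ge0.
Qed.

Lemma endpoint_in_ball : U (x + h).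
Proof.
by apply: bU; rewrite -{1}(scale1r h); apply: (@segment_in_ball 1); rewrite ler01 lexx.
Qed.

Lemma neg_first_order : M * L < - complex.Re (F x) -> complex.Re (F (x + h)) < 0.
Proof.
move=> ML; apply: le_lt_trans (_ : complex.Re (F x) + M * L < _).
  apply: (taylor1 (classCW cF)) => t /segment_in_ball tb; split; first exact: bU.
  apply: le_trans (rdir_bound oU (bU tb) (classCW cF) hM) _.
  by rewrite ler_wpM2l // bL.
by rewrite -ltrBrDl sub0r.
Qed.

Lemma neg_second_order : complex.Re (rdir h F x) <= 0 ->
  M ^+ 2 * N < - complex.Re (F x) -> complex.Re (F (x + h)) < 0.
Proof.
move=> h0 MN; apply: le_lt_trans (_ : complex.Re (F x) + M ^+ 2 * N < _).
  apply: (taylor2 cF h0) => t /segment_in_ball tb; split; first exact: bU.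
  apply: le_trans (rdir2_bound oU (bU tb) cF M0 hM) _.
  by rewrite ler_wpM2l ?bN // sqr_ge0.
by rewrite -ltrBrDl sub0r.
Qed.

End Ball.

Lemma small_scale (A : R) : 0 <= A -> exists a : R, [/\ 0 < a, a <= 1 &
  forall X, X <= A -> a * X < 1].
Proof.
move=> A0; have A1 : 0 < 1 + A by rewrite ltr_pwDl.
exists (1 + A)^-1; split; first by rewrite invr_gt0.
  by rewrite invf_le1 // lerDl.
by move=> X XA; rewrite mulrC ltr_pdivrMr // mul1r; apply: le_lt_trans XA _; rewrite ltrDr.
Qed.

Lemma coord_tangent (k i0 j : 'I_m) (zeta b : Cx R) :
  (zeta *: (evec R k - b *: evec R i0)) 0 j = zeta * ((j == k)%:R - b * (j == i0)%:R).
Proof. by rewrite !mxE eqxx. Qed.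

Lemma sum_dz_tangent (k i0 : 'I_m) (zeta : Cx R) (d : 'I_m -> Cx R) : d i0 != 0 ->
  \sum_j (zeta *: (evec R k - (d k / d i0) *: evec R i0)) 0 j * d j = 0.
Proof.
move=> d0; under eq_bigr => j _ do rewrite coord_tangent -mulrA mulrBl.
rewrite -mulr_sumr sumrB (bigD1 k) //= eqxx mul1r big1 ?addr0; last first.
  by move=> j /negbTE ->; rewrite mul0r.
rewrite (bigD1 i0) //= eqxx mulr1 big1 ?addr0; last first.
  by move=> j /negbTE ->; rewrite mulr0 mul0r.
by rewrite divfK // subrr mulr0.
Qed.

(** Let [s = - F(x)]. By [dist_bdry_le], [s] dominates the distance to the boundary.
In any direction [F] changes by [O(|h|)], so it stays negative on a disc of radius [a s]. The
vectors [e_k - b_k e_i0] with [b_k = d_k F / d_i0 F] are complex tangent to the level set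
of [F] through [x]; along them [F] changes by [O(|h|^2)], which allows the radius
[a sqrt s]. *)
Theorem boundary_discs (D U : set V) F p v : open D -> open U -> U p -> bdry D p ->
  classC 2 U F -> (forall z, U z -> complex.Im (F z) = 0) ->
  (forall z, U z -> (D z <-> complex.Re (F z) < 0)) -> rdir v F p != 0 ->
  exists (i0 : 'I_m) (a : R), 0 < a /\
    \forall x \near p, D x -> exists (s : R) (b : 'I_m -> Cx R),
      [/\ 0 < s, b i0 = 0, a * dist_bdry D x <= s,
        (forall zeta : Cx R, cabs zeta <= a * s -> D (x + zeta *: evec R i0)) &
        forall k, k != i0 -> forall zeta : Cx R, cabs zeta <= a * Num.sqrt s ->
          D (x + zeta *: (evec R k - b k *: evec R i0))].
Proof.
move=> oD oU Up bp cF rF DU vp.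
have [i0 [n [c [L [N [B [r [[c0 L0 N0 B0 r0] hball]]]]]]]] :=
  boundary_local_bounds oU Up cF rF vp.
have B1 : 0 < 1 + B by rewrite ltr_pwDl.
(* the scale [a] is small against every constant of the estimates below *)
have [a [a0 a1 ha]] : exists a : R, [/\ 0 < a, a <= 1 &
    forall X, X <= L + (1 + B) ^+ 2 * N + (1 + B) / (r / 2) + eucl_norm n / c -> a * X < 1].
  by apply: small_scale; rewrite !addr_ge0 ?mulr_ge0 ?invr_ge0 ?sqr_ge0 ?eucl_norm_ge0 //
    ltW ?divr_gt0.
have tail3 : 0 <= eucl_norm n / c by rewrite divr_ge0 ?eucl_norm_ge0 // ltW.
have tail2 : 0 <= (1 + B) / (r / 2) by rewrite divr_ge0 // ltW ?divr_gt0.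
have tail1 : 0 <= (1 + B) ^+ 2 * N by rewrite mulr_ge0 ?sqr_ge0.
have aL : a * L < 1 by apply: ha; rewrite -!addrA lerDl !addr_ge0.
have aN : a * ((1 + B) ^+ 2 * N) < 1.
  by apply: ha; rewrite -!addrA addrCA lerDl !addr_ge0.
have aB : a * (1 + B) < r / 2.
  rewrite -[ltRHS]mul1r -ltr_pdivrMr ?divr_gt0 // -mulrA; apply: ha.
  by rewrite addrAC lerDr !addr_ge0.
have ac : a * (eucl_norm n / c) < 1 by apply: ha; rewrite lerDr !addr_ge0.
clear ha tail2 tail3.
have n1 : 0 < rnorm n + 1 := ltr_wpDl (rnorm_ge0 n) ltr01.
(* for [s < sigma] the segment from [x] to the boundary stays in the ball *)
pose sigma := Num.min 1 (c * (r / 2) / (rnorm n + 1)).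
have sigma0 : 0 < sigma by rewrite lt_min ltr01 /= divr_gt0 // mulr_gt0 // divr_gt0.
have Fp : 0 <= complex.Re (F p).
  rewrite leNgt; apply/negP => /(DU p Up) Dp; apply: bp.2.
  by rewrite (interior_id _).1.
exists i0, a; split=> //; near=> x => Dx.
have xr : rnorm (x - p) < r / 2.
  by near: x; apply/nbhs_rnorm; exists (r / 2) => //; rewrite divr_gt0.
have xr' : rnorm (x - p) < r by apply: lt_trans xr _; rewrite ltr_pdivrMr // ltr_pMr // ltr1n.
have [[Ux _] _ _ zi0 hb] := hball x xr'.
pose s := - complex.Re (F x).
have s0 : 0 < s by rewrite oppr_gt0; apply/DU.
have ssig : s < sigma.
  rewrite ltrNl; near: x; apply: near_Re_gt.
    exact: classC_continuous cF Up.
  by apply: lt_le_trans Fp; rewrite oppr_lt0.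
have s1 : s <= 1 by apply: ltW; apply: lt_le_trans ssig _; rewrite ge_min lexx.
have sn : s * (rnorm n + 1) < c * (r / 2).
  by rewrite -ltr_pdivlMr //; apply: lt_le_trans ssig _; rewrite ge_min lexx orbT.
have bU z : rnorm (z - p) < r -> U z by move=> /hball[[]].
have bL z : rnorm (z - p) < r -> \sum_j cabs (rdir (rframe R j) F z) <= L.
  by move=> /hball[].
have bN z : rnorm (z - p) < r ->
    \sum_i \sum_j cabs (rdir (rframe R i) (rdir (rframe R j) F) z) <= N.
  by move=> /hball[].
exists s, (fun k => if k == i0 then 0 else dz k F x / dz i0 F x); split.
- exact: s0.
- by rewrite eqxx.
- have T0 : 0 <= s / c by rewrite divr_ge0 // ltW.
  apply: le_trans (_ : a * (s / c * eucl_norm n) <= _).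
    rewrite ler_pM2l //; apply: (dist_bdry_le (U := U) (c := c) oD oU (classCW cF)) => //.
      by rewrite mulrC divfK // gt_eqF.
    move=> t /andP[t0 tT]; suff /hball[[? ?] _ _ _ _] : rnorm (x + t **: n - p) < r by [].
    rewrite addrAC [r]splitr; apply: le_lt_trans (rnormD _ _) _; apply: ltrD => //.
    rewrite rnorm_scale ger0_norm // -(ltr_pM2l c0); apply: le_lt_trans sn.
    rewrite mulrA; apply: ler_pM; rewrite ?rnorm_ge0 ?lerDl // ?mulr_ge0 // ?(ltW c0) //.
    by rewrite mulrC -ler_pdivlMr.
  have -> : a * (s / c * eucl_norm n) = s * (a * (eucl_norm n / c)) by ring.
  by rewrite ler_piMr // ltW.
- move=> zeta hz; have z0 := cabs_ge0 zeta.
  have za : cabs zeta <= a by apply: le_trans hz _; rewrite ler_piMr // ltW.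
  have hM k : cabs ((zeta *: evec R i0) 0 k) <= cabs zeta.
    by rewrite !mxE eqxx cabsM ler_piMr //; case: (k == i0); rewrite ?cabs1 ?cabs0.
  have zr : cabs zeta < r / 2.
    apply: le_lt_trans za _; apply: le_lt_trans aB; rewrite ler_peMr ?(ltW a0) //.
    by rewrite lerDl.
  apply/DU; first exact: (endpoint_in_ball bU z0 hM xr zr).
  apply: (neg_first_order oU cF bU bL z0 hM xr zr).
  apply: le_lt_trans (_ : a * s * L < _); first by rewrite ler_wpM2r.
  by rewrite mulrAC -[ltRHS]mul1r ltr_pM2r.
- move=> k ki0 zeta hz; rewrite (negbTE ki0); have z0 := cabs_ge0 zeta.
  have za : cabs zeta <= a.
    apply: le_trans hz _; rewrite ler_piMr ?(ltW a0) //.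
    by rewrite -sqrtr1 ler_wsqrtr.
  set h := zeta *: _.
  have M0 : 0 <= cabs zeta * (1 + B) by rewrite mulr_ge0 // ltW.
  have hM j : cabs (h 0 j) <= cabs zeta * (1 + B).
    rewrite coord_tangent cabsM ler_wpM2l //; apply: le_trans (cabsD _ _) _.
    rewrite cabsN cabsM lerD //; first by case: (j == k); rewrite ?cabs1 ?cabs0.
    apply: le_trans (hb k); rewrite ler_piMr ?cabs_ge0 //.
    by case: (j == i0); rewrite ?cabs1 ?cabs0.
  have Mr : cabs zeta * (1 + B) < r / 2.
    by apply: le_lt_trans aB; rewrite ler_pM2r.
  apply/DU; first exact: (endpoint_in_ball bU M0 hM xr Mr).
  apply: (neg_second_order oU cF bU bN M0 hM xr Mr).
    rewrite (Re_rdir_dz oU h (classCW cF) Ux rF).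
    by rewrite (sum_dz_tangent k zeta (d := fun k => dz k F x) zi0) mulr0.
  rewrite exprMn -mulrA; apply: le_lt_trans (_ : (a * Num.sqrt s) ^+ 2 * ((1 + B) ^+ 2 * N) < _).
    rewrite (ler_wpM2r tail1) //.
    by rewrite lerXn2r ?nnegrE // (le_trans z0 hz).
  rewrite exprMn sqr_sqrtr ?(ltW s0) // expr2 -/s.
  have -> : a * a * s * ((1 + B) ^+ 2 * N) = s * (a * (a * ((1 + B) ^+ 2 * N))) by ring.
  rewrite -[ltRHS]mulr1 ltr_pM2l //; apply: le_lt_trans aN.
  by rewrite ler_piMl // mulr_ge0 // ltW.
Unshelve. all: by end_near.
Qed.

End BoundaryDiscs.

(** * Biholomorphisms onto a domain as charts *)

Section BiholomorphicCharts.
Context (R : realType) (m : nat) (M : complex_manifold R m).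
Local Notation V := 'rV[Cx R]_m.

Lemma holo_from_continuous (N : set M) (f : M -> V) x :
  holo_from N f -> N x -> {for x, continuous f}.
Proof.
move=> hf Nx; have [c ac cx] := cm_cover x.
have [oc _ ci cc _] := cm_charts ac.
have fc := differentiable_continuous (hf c x ac cx Nx).
have h : ((f \o chart_inv c) \o chart_map c) y @[y --> x] --> f x.
  have -> : f x = (f \o chart_inv c) (chart_map c x) by rewrite /= ci.
  exact: continuous_comp (cc x cx) fc.
apply: cvg_trans h; apply: near_eq_cvg.
have : \forall y \near x, chart_dom c y by exact: open_nbhs_nbhs.
by apply: filterS => y cy; rewrite /= ci.
Qed.

(** The maximality of the atlas turns a biholomorphism onto an open set of [C^m]
into a chart. *)
Lemma biholomorphism_chart (N : set M) (D : set V) (f : M -> V) :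
  open N -> open D -> biholomorphism N D f ->
  exists2 c : chart R m M, cm_atlas c &
    [/\ chart_dom c = N, chart_img c = D & chart_map c = f].
Proof.
move=> oN oD [[fN fi fs] hf [g [hg gf]]].
have imgE : f @` N = D.
  apply/seteqP; split; last exact: fs.
  by move=> _ [x Nx <-]; exact: fN.
exists (Chart N f g) => //; apply: cm_maximal.
  split=> //=.
  - by rewrite /chart_img /= imgE.
  - by move=> x Nx; exact: holo_from_continuous hf Nx.
  - by move=> z [x Nx <-]; have [] := hg (f x) (fN x Nx).
move=> c' ac'; split=> x /= Nx c'x.
  have [_ h] := hg (f x) (fN x Nx).
  by apply: h => //; rewrite gf.
exact: hf.
Qed.

Lemma monotone_union_mem (D : set V) (N : nat -> set M) (f : nat -> M -> V) q :
  monotone_union D N f -> \forall j \near \oo, N j q.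
Proof.
move=> [oN Nc Ncov _].
have [j0 _ qj0] : (\bigcup_j N j) q by rewrite Ncov.
exists j0 => // j /=; elim: j => [|j IH]; first by rewrite leqn0 => /eqP <-.
rewrite leq_eqVlt => /orP[/eqP <- //|/IH Nj].
by apply: (Nc j).2; exact: subset_closure.
Qed.

End BiholomorphicCharts.

(** * The adapted frame *)

Section Frame.
Context (R : realType) (m : nat).

(** Adding multiples of [e_i0] to the other vectors does not change the determinant. *)
Lemma det_tangent_frame (i0 : 'I_m) (b : 'I_m -> Cx R) : b i0 = 0 ->
  \det (\matrix_k (evec R k - b k *: evec R i0)) = 1.
Proof.
case: m i0 b => [[]//|m' i0 b b0].
set P := \matrix_k _.
have PE k j : P k j = (j == k)%:R - b k * (j == i0)%:R.
  by rewrite !mxE eqxx.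
rewrite (expand_det_row P i0) (bigD1 i0) //= big1 ?addr0; last first.
  by move=> j /negbTE ji; rewrite PE b0 ji mul0r subr0 mul0r.
rewrite PE b0 eqxx mul0r subr0 mul1r /cofactor addnn -signr_odd odd_double expr0 mul1r.
rewrite (_ : row' _ _ = 1%:M) ?det1 //; apply/matrixP => k j.
rewrite [LHS]mxE [LHS]mxE PE mxE (inj_eq lift_inj) eq_sym.
by rewrite (eq_sym _ i0) (negbTE (neq_lift _ _)) mulr0 subr0.
Qed.

Lemma prod_frame_bounds (i0 : 'I_m) (Q s : R) : 0 < s ->
  \prod_k (if k == i0 then Q / s ^+ 2 else Q / s) = Q ^+ m / s ^+ m.+1.
Proof.
move=> s0; rewrite (bigD1 i0) //= eqxx.
under eq_bigr => k /negbTE -> do [].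
rewrite prodr_const.
have -> : #|[pred k | k != i0]| = m.-1.
  by rewrite cardC1 card_ord.
case: m i0 => [[]//|m' _] /=.
by rewrite expr_div_n exprS !exprS; field; rewrite ?expf_neq0 ?gt_eqF.
Qed.

End Frame.

(** * Lower bound for the Jacobian *)

Section DeterminantBound.
Context (R : realType) (m : nat).
Local Notation V := 'rV[Cx R]_m.

(** [schwarz_disc] in the [m] directions of the adapted frame, combined by
[posdef_det_le]: one radius of order [s] and [m - 1] radii of order
[sqrt s] make up the exponent [m + 1]. *)
Lemma det_metric_le (D : set V) (g : V -> 'M[Cx R]_m) (K : R) x
    (i0 : 'I_m) (b : 'I_m -> Cx R) (a s : R) : open D ->
  (forall z, D z -> posdef (g z)) ->
  (forall i j, classC 2 D (fun z => g z i j)) -> 0 < K ->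
  (forall z v, D z -> v != 0 -> hol_sect_curv g z v <= - K) ->
  D x -> 0 < a -> 0 < s -> b i0 = 0 ->
  (forall zeta : Cx R, cabs zeta <= a * s -> D (x + zeta *: evec R i0)) ->
  (forall k, k != i0 -> forall zeta : Cx R, cabs zeta <= a * Num.sqrt s ->
     D (x + zeta *: (evec R k - b k *: evec R i0))) ->
  cabs (\det (g x)) <= m`!%:R * ((2 / (K * a ^+ 2)) ^+ m / s ^+ m.+1).
Proof.
move=> oD pg sg K0 cK Dx a0 s0 b0 disc0 disck.
pose e k := evec R k - b k *: evec R i0.
have e0 k : e k != 0.
  have ek1 : e k 0 k = 1.
    rewrite /e !mxE !eqxx; have [->|ki] := eqVneq k i0.
      by rewrite b0 mul0r subr0.
    by rewrite mulr0 subr0.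
  by apply/eqP => ez; move: ek1; rewrite ez mxE => /esym/eqP; rewrite oner_eq0.
have ei0 : e i0 = evec R i0 by rewrite /e b0 scale0r subr0.
have rs : 0 < Num.sqrt s by rewrite sqrtr_gt0.
have bound k (rho : R) : 0 < rho ->
    (forall zeta : Cx R, cabs zeta <= rho -> D (x + zeta *: e k)) ->
    complex.Re (sesq (g x) (e k) (e k)) <= 2 / K / rho ^+ 2.
  move=> rho0 hd; rewrite ler_pdivlMr ?exprn_gt0 //.
  exact: schwarz_disc oD pg sg K0 cK _ _ _ rho0 (e0 k) hd.
rewrite -(prod_frame_bounds i0 _ s0).
have := @posdef_det_le R m (g x) (\matrix_k e k)
  (fun k => if k == i0 then 2 / (K * a ^+ 2) / s ^+ 2 else 2 / (K * a ^+ 2) / s) (pg x Dx).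
rewrite (det_tangent_frame b0) cabs1 expr1n mul1r; apply => k; rewrite rowK.
have [->|ki] := eqVneq k i0.
  apply: le_trans (bound i0 (a * s) (mulr_gt0 a0 s0) _) _; first by rewrite ei0.
  by rewrite exprMn !invfM !mulrA.
apply: le_trans (bound k (a * Num.sqrt s) (mulr_gt0 a0 rs) (disck k ki)) _.
by rewrite exprMn sqr_sqrtr ?(ltW s0) // !invfM !mulrA.
Qed.

(** [H] is the determinant of the metric at [q], which is independent of the index of
the sequence. *)
Lemma jacobian_lower_bound (H Q J dG a s delta : R) :
  0 < H -> 0 < Q -> 0 < a -> 0 < delta -> 0 <= J -> a * delta <= s ->
  H = J ^+ 2 * dG -> dG <= Q / s ^+ m.+1 ->
  Num.sqrt (H * a ^+ m.+1 / Q) <= J / delta `^ (m.+1%:R / 2).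
Proof.
move=> H0 Q0 a0 d0 J0 ads HE dGle.
have s0 : 0 < s by apply: lt_le_trans ads; exact: mulr_gt0.
have dp : 0 < delta `^ (m.+1%:R / 2) by exact: powR_gt0.
have dp2 : (delta `^ (m.+1%:R / 2)) ^+ 2 = delta ^+ m.+1.
  rewrite -powR_mulrn ?powR_ge0 // -powRrM divfK ?pnatr_eq0 //.
  by rewrite powR_mulrn // ltW.
have N0 : 0 <= H * a ^+ m.+1 / Q.
  by rewrite divr_ge0 ?(ltW Q0) // mulr_ge0 ?(ltW H0) // exprn_ge0 // ltW.
rewrite ler_pdivlMr // -(ler_pXn2r (n := 2)) ?nnegrE ?mulr_ge0 ?sqrtr_ge0 ?(ltW dp) //.
rewrite exprMn sqr_sqrtr // dp2 mulrAC ler_pdivrMr // -mulrA -exprMn.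
apply: le_trans (_ : H * s ^+ m.+1 <= _).
  by rewrite ler_pM2l // lerXn2r ?nnegrE ?mulr_ge0 ?(ltW a0) ?(ltW d0) ?(ltW s0).
rewrite HE -mulrA ler_wpM2l ?sqr_ge0 //.
by rewrite -ler_pdivlMr // exprn_gt0.
Qed.

End DeterminantBound.

Theorem proposition3p1 (R : realType) (m : nat) (M : complex_manifold R m)
    (h : chart R m M -> 'rV[Cx R]_m -> 'M[Cx R]_m) (K k : R)
    (Omega : set 'rV[Cx R]_m) (Mj : nat -> set M)
    (f : nat -> M -> 'rV[Cx R]_m) (q : M) (p : 'rV[Cx R]_m)
    (hh : hermitian_metric h) (hK : 0 < K) (hcurv : hol_sect_curv_le h (- K))
    (hOmega : bounded_domain Omega)
    (hcomplete : complete_metric Omega (bergman_metric Omega))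
    (hk : 0 < k) (hricci : ricci_ge Omega (bergman_metric Omega) (- k))
    (hunion : monotone_union Omega Mj f)
    (hp : strongly_psc_point Omega p)
    (hq : (fun j => f j q) @ \oo --> p)
    (c : chart R m M) (hc : cm_atlas c) (hqc : chart_dom c q) :
  exists2 eta : R, 0 < eta &
    \forall j \near \oo,
      eta <= cabs (\det ('J (f j \o chart_inv c) (chart_map c q)))
             / dist_bdry Omega (f j q) `^ (m.+1%:R / 2).
Proof.
have [_ oD _ _] := hOmega; have [hsm hpos htrans] := hh.
have [bp [U [r [[oU Up] cr rU [v rv] _]]]] := hp.
have rU' z : U z -> (Omega z <-> complex.Re ((r z)%:C%C : Cx R) < 0) by exact: rU.
have [i0 [a [a0 hdisc]]] := boundary_discs oD oU Up bp cr (fun z _ => erefl) rU' rv.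
have ph : posdef (h c (chart_map c q)).
  by apply: hpos => //; exists q.
pose H := cabs (\det (h c (chart_map c q))).
have H0 : 0 < H by apply: cabs_gt0; rewrite -unitfE -unitmxE; exact: posdef_unit.
pose Q : R := m`!%:R * (2 / (K * a ^+ 2)) ^+ m.
have Q0 : 0 < Q.
  by rewrite mulr_gt0 ?ltr0n ?fact_gt0 // exprn_gt0 // divr_gt0 // mulr_gt0 // exprn_gt0.
exists (Num.sqrt (H * a ^+ m.+1 / Q)).
  by rewrite sqrtr_gt0 divr_gt0 // mulr_gt0 // exprn_gt0.
apply: filterS2 (monotone_union_mem q hunion) (hq _ hdisc) => j Nq.
have [oN _ _ biho] := hunion.
have [[fN _ _] _ _] := biho j.
have Dx : Omega (f j q) by exact: fN.
have [cj acj [cjN cjD cjf]] := biholomorphism_chart (oN j) oD (biho j).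
move=> /(_ Dx)[s [b [s0 b0 ads disc0 disck]]].
have detG : cabs (\det (h cj (f j q))) <= Q / s ^+ m.+1.
  rewrite /Q -mulrA; apply: (det_metric_le oD _ _ hK _ Dx a0 s0 b0 disc0 disck).
  - by move=> z Dz; apply: hpos => //; rewrite cjD.
  - by move=> i l; have := hsm cj acj i l 2; rewrite cjD.
  - by move=> z w Dz w0; apply: hcurv => //; rewrite cjD.
apply: (jacobian_lower_bound H0 Q0 a0 _ (cabs_ge0 _) ads _ detG).
  by apply: dist_bdry_gt0 => //; exists p.
have := htrans c cj q hc acj hqc; rewrite cjN => /(_ Nq) /= E.
rewrite /H E !det_mulmx det_map_mx det_tr !cabsM cabs_conj /transition cjf.
by rewrite expr2 mulrAC.
Qed.
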